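(* Suppose that for every $r\ge2$ the set of all infinite type maps in $\mathrm{ITM}(r)$ has Lebesgue measure zero (the Boshernitzan--Kornfeld Conjecture). Then for every $r\ge 2$ the set of all $T\in\mathrm{ITM}(r)$ that correspond to irrational circle rotations has full Lebesgue measure in $\mathrm{ITM}(r)$ (the Irrational Rotations Conjecture).
   Context: Let $I=[0,1)$. An interval translation mapping (ITM) on $r$ intervals is a map $T:I\to I$ given by parameters $0=\beta_0<\beta_1<\dots<\beta_{r-1}<\beta_r=1$ and $\gamma_1,\dots,\gamma_r\in\mathbb R$ with $\gamma_i\in[-\beta_{i-1},1-\beta_i]$, via $T(x)=x+\gamma_i$ for $x\in I_i=[\beta_{i-1},\beta_i)$. $\mathrm{ITM}(r)\subset\mathbb R^{2r-1}$ is the set of parameter vectors $(\gamma_1,\dots,\gamma_r,\beta_1,\dots,\beta_{r-1})$, equipped with $(2r-1)$-dimensional Lebesgue measure; maps are identified with their parameters. $X(T)=\bigcap_{n\ge0}T^n(I)$, whose closure is the non-wandering set of $T$. $T$ is of finite type if $T^{n+1}(I)=T^n(I)$ for some $n$ (then $X(T)$ is a finite union of half-open intervals), and of infinite type otherwise. A map $T$ corresponds to an irrational circle rotation if it is of finite type and, for every component interval $J$ of $X(T)$, the first return map of $T$ to $J$ is equivalent to an irrational circle rotation, i.e. after affinely rescaling $J$ to $[0,1)$ it is $z\mapsto z+\alpha \bmod 1$ for some irrational $\alpha$. *)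

(* Defs.v *)
From HB Require Import structures.
From mathcomp Require Import all_boot all_order all_algebra.
From mathcomp Require Import all_classical all_reals all_analysis.
Import Order.TTheory GRing.Theory Num.Theory.
Import numFieldNormedType.Exports.

Set Implicit Arguments.
Unset Strict Implicit.
Unset Printing Implicit Defensive.

Local Open Scope classical_set_scope.
Local Open Scope ring_scope.

(* n-dimensional Lebesgue measure on n-tuples of reals, by recursion on n: the
   image of the product of the one-dimensional measure with the n-dimensional
   one under (x, t) |-> x :: t. *)
Section lebesgue_tuple.
Context {R : realType}.

Definition cons_pair n (p : R * n.-tuple R) : n.+1.-tuple R :=
  [tuple of p.1 :: p.2].

Lemma measurable_cons_pair n : measurable_fun [set: R * n.-tuple R] (@cons_pair n).
Proof. exact: measurable_cons. Qed.

Section cons_measure.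
Context (n : nat) (mu : {sigma_finite_measure set (n.-tuple R) -> \bar R}).

Definition cons_measure : set (n.+1.-tuple R) -> \bar R :=
  pushforward (lebesgue_measure \x mu)%E (@cons_pair n).

Let cons_measure_class : {measure set (n.+1.-tuple R) -> \bar R} :=
  measure_function_pushforward__canonical__measure_function_Measure
    (lebesgue_measure \x mu)%E (@measurable_cons_pair n).

HB.instance Definition _ := isMeasure.Build _ _ _ cons_measure
  (@measure0 _ _ _ cons_measure_class) (@measure_ge0 _ _ _ cons_measure_class)
  (@measure_semi_sigma_additive _ _ _ cons_measure_class).

Lemma cons_measure_sigma_finite : sigma_finite setT cons_measure.
Proof.
have /sigma_finiteP[F [FT ndF Ffin]] := sigma_finiteT (@lebesgue_measure R).
have /sigma_finiteP[G [GT ndG Gfin]] := sigma_finiteT mu.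
pose uncons (t : n.+1.-tuple R) := (tnth t ord0, [tuple of behead t]).
have unconsK p : uncons (cons_pair p) = p.
  by case: p => x t; congr pair; apply: val_inj.
have muncons : measurable_fun setT uncons.
  exact: measurable_fun_pair (measurable_tnth _) (@measurable_behead _ _ _).
exists (fun k => uncons @^-1` (F k `*` G k)).
  rewrite -preimage_bigcup (_ : \bigcup_k _ = setT) ?preimage_setT//.
  rewrite -subTset => -[x t] _.
  have [i _ Fx] : (\bigcup_i F i) x by rewrite -FT.
  have [j _ Gt] : (\bigcup_j G j) t by rewrite -GT.
  exists (maxn i j) => //; split=> /=.
  - by move: x Fx; exact/subsetPset/ndF/leq_maxl.
  - by move: t Gt; exact/subsetPset/ndG/leq_maxr.
move=> k; have [mF Fk] := Ffin k; have [mG Gk] := Gfin k; split.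
  by rewrite -[X in measurable X]setTI; apply: muncons => //; exact: measurableX.
rewrite /cons_measure /pushforward (_ : _ @^-1` _ = F k `*` G k).
  by rewrite product_measure1E// lte_mul_pinfty// ge0_fin_numE.
by apply/funext => p; rewrite -[in RHS](unconsK p).
Qed.

HB.instance Definition _ :=
  Measure_isSigmaFinite.Build _ _ _ cons_measure cons_measure_sigma_finite.

End cons_measure.

Fixpoint lebesgue_tuple n : {sigma_finite_measure set (n.-tuple R) -> \bar R} :=
  if n is m.+1 then cons_measure (lebesgue_tuple m) else dirac [tuple].

Lemma lebesgue_tuple_box n (A : 'I_n -> set R) : (forall i, measurable (A i)) ->
  lebesgue_tuple n [set t | forall i, A i (tnth t i)] =
  (\prod_(i < n) lebesgue_measure (A i))%E.
Proof.
elim: n A => [|n IH] A mA.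
  by rewrite big_ord0 /= diracE mem_set//=; case.
rewrite big_ord_recl.
have mB : measurable [set t : n.-tuple R | forall i : 'I_n, A (lift ord0 i) (tnth t i)].
  rewrite (_ : [set _ | _] =
    \bigcap_(i in [set: 'I_n]) ((@tnth n R)^~ i @^-1` A (lift ord0 i))).
    apply: fin_bigcap_measurable => // i _; rewrite -[X in measurable X]setTI.
    exact: measurable_tnth.
  by apply/seteqP; split => t /= h i; [move=> _|]; exact: h.
have := product_measure1E lebesgue_measure (lebesgue_tuple n) (mA ord0) mB.
rewrite (IH (fun i => A (lift ord0 i)))// => <-.
congr ((_ \x _)%E _); apply/seteqP.
split => -[x t] /= => [h|[h0 h] i].
  by split=> [|i]; [exact: (h ord0)|rewrite -(tnthS x); exact: h].
by have [j ->|->//] := unliftP ord0 i; rewrite tnthS.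
Qed.

End lebesgue_tuple.
Arguments lebesgue_tuple R n : clear implicits.

Section interval_translation_mappings.
Context {R : realType}.

Local Notation I := (`[0, 1[%classic : set R).

(* A parameter vector is t = (gamma_1, ..., gamma_r, beta_1, ..., beta_{r-1}).
   [itm_gamma t i] is gamma_{i+1}, the translation on [beta_i, beta_{i+1}), and
   [itm_beta r t i] is beta_i, for 0 <= i <= r, with beta_0 = 0, beta_r = 1. *)
Definition itm_gamma (t : seq R) (i : nat) : R := nth 0 t i.

Definition itm_beta (r : nat) (t : seq R) (i : nat) : R :=
  nth 0 (0 :: rcons (drop r t) 1) i.

Definition ITM (r : nat) : set ((2 * r - 1).-tuple R) :=
  [set t | forall i, (i < r)%N ->
     itm_beta r t i < itm_beta r t i.+1 /\
     itm_gamma t i \in `[- itm_beta r t i, 1 - itm_beta r t i.+1]].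

(* For x in [0, 1) exactly one index contributes to the sum; the value outside
   [0, 1) (namely x) is irrelevant. *)
Definition itm_map (r : nat) (t : seq R) (x : R) : R :=
  x + \sum_(i < r | x \in `[itm_beta r t i, itm_beta r t i.+1[) itm_gamma t i.

Definition iter_image (T : R -> R) (n : nat) : set R := iter n T @` I.

Definition attractor (T : R -> R) : set R := \bigcap_n iter_image T n.

Definition finite_type (T : R -> R) : Prop :=
  exists n, iter_image T n.+1 = iter_image T n.

(* y is the image of x under the first return map of T to J. *)
Definition first_return (T : R -> R) (J : set R) (x y : R) : Prop :=
  exists n, [/\ (0 < n)%N, iter n T x = y, J y &
    forall m, (0 < m < n)%N -> ~ J (iter m T x)].

Definition rotation (alpha z : R) : R :=
  z + alpha - (Num.floor (z + alpha))%:~R.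

Definition first_return_irrational_rotation (T : R -> R) (J : set R) : Prop :=
  exists a b alpha : R, [/\ a < b, J = `[a, b[%classic, irrational alpha &
    forall x, J x ->
      first_return T J x (a + (b - a) * rotation alpha ((x - a) / (b - a)))].

(* The component intervals of the attractor are its connected components. *)
Definition irrational_rotation_type (T : R -> R) : Prop :=
  finite_type T /\
  forall x, attractor T x ->
    first_return_irrational_rotation T (connected_component (attractor T) x).

Definition infinite_type_maps (r : nat) : set ((2 * r - 1).-tuple R) :=
  [set t | ITM t /\ ~ finite_type (itm_map r t)].

Definition irrational_rotation_maps (r : nat) : set ((2 * r - 1).-tuple R) :=
  [set t | ITM t /\ irrational_rotation_type (itm_map r t)].

End interval_translation_mappings.
Arguments ITM R r : clear implicits.
Arguments infinite_type_maps R r : clear implicits.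
Arguments irrational_rotation_maps R r : clear implicits.

(* Main.v *)
Require Import Defs.
From mathcomp Require Import all_boot all_order all_algebra.
From mathcomp Require Import all_classical all_reals all_analysis.
From mathcomp Require Import ring lra zify.
Import Order.TTheory GRing.Theory Num.Theory.
Import numFieldNormedType.Exports.

Set Implicit Arguments.
Unset Strict Implicit.
Unset Printing Implicit Defensive.

Local Open Scope classical_set_scope.
Local Open Scope ring_scope.

(** Call a parameter vector resonant when its entries [gamma_i], [beta_j]
    satisfy a nontrivial linear relation with integral coefficients.  Resonant
    vectors form a countable union of hyperplanes, so they are negligible
    ([hyperplane_null]), and so are infinite type maps by assumption.  What has
    to be shown is deterministic: a finite type map [T] with non-resonant
    parameters corresponds to irrational rotations ([generic_finite_type]).

    Let [X] be the attractor.  It is a finite union of half-open intervals with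
    [T X = X], and comparing lengths shows that [T] is injective on [X]
    ([tame_injective]).  Let [[a, b)] be a component of [X].  A point of its
    interior is a breakpoint of the first return map when its orbit meets some
    discontinuity [beta_i] before returning; injectivity makes [i] determine the
    breakpoint.  The breakpoints cut [[a, b)] into finitely many columns, each
    of which moves as a block through pairwise disjoint levels and comes back as
    a tile; the tiles cover [[a, b)] again.  Non-resonance forbids periodic
    points, so the tile with left end [a] and the tile with right end [b] come
    from columns whose left, respectively right, end is a breakpoint.  With two
    columns the return map therefore exchanges them: it is a rotation, and a
    rational angle would be a resonance ([component_rotation]).

    The heart is [ncol_le2]: there are at most two columns.  Give each
    translation [gamma_i] a velocity [w i], let the columns stand still, and let
    every higher level drift with the sum of the velocities met along its orbit.
    For this to be consistent, the velocities must add up to zero along every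
    return.  Non-resonance makes additive relations between the endpoints hold
    formally, so it suffices to impose this on two returns, the ones that
    produce [a] and [b] ([killed_returns]).  Ask moreover, at each threshold
    [beta_i], that the last level on its left and the first level on its right
    drift at the same speed; this is automatic when [beta_i] is met by a
    breakpoint.  With three or more columns these are fewer than [r] linear
    equations, so a nonzero solution [w] exists.  But no such motion is possible
    ([levels_rigid]): follow the drifting levels until two of them collide for
    the first time.  They are neighbours, and they lie in the same interval of
    continuity because levels that face each other across a threshold keep
    their distance.  So their images under [T] collide at the same time, and so
    on forever.  An endpoint orbit among finitely many levels must repeat, which
    is a resonance.  Hence all levels stand still and [w] vanishes. *)

(** * Preliminaries on finite families *)
Lemma exists_seq_min (R : realDomainType) (T : eqType) (f : T -> R) (q : seq T) :
  q != [::] -> exists2 x, x \in q & forall y, y \in q -> f x <= f y.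
Proof.
elim: q => // x [|z q] IH _.
  by exists x; rewrite ?mem_head// => y; rewrite inE => /eqP->.
have [y yq my] := IH isT; have [xy|yx] := leP (f x) (f y).
  exists x; rewrite ?mem_head// => u; rewrite inE => /predU1P[->//|uq].
  exact: le_trans xy (my _ uq).
exists y; first by rewrite inE yq orbT.
by move=> u; rewrite inE => /predU1P[->|/my//]; exact: ltW.
Qed.

Lemma exists_fin_min (R : realDomainType) (T : finType) (P : pred T) (f : T -> R) :
  (exists x, P x) -> exists2 x, P x & forall y, P y -> f x <= f y.
Proof.
move=> [x0 Px0]; have : enum P != [::].
  by apply/eqP => e; have := mem_enum P x0; rewrite e in_nil unfold_in Px0.
move=> /(exists_seq_min f)[x]; rewrite mem_enum => Px mx; exists x => // y Py.
by apply: mx; rewrite mem_enum.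
Qed.

Lemma iter_fin_cycle (T : finType) (f : T -> T) x :
  exists i j, (i < j)%N /\ iter i f x = iter j f x.
Proof.
pose F (i : 'I_#|T|.+1) := iter i f x.
have /injectivePn[i [j ij e]] : ~~ injectiveb F.
  apply/negP => /injectiveP /leq_card; by rewrite card_ord ltnn.
have := ij; rewrite -val_eqE neq_ltn => /orP[] h.
  by exists i, j.
by exists j, i; split.
Qed.

(** * Drifting levels never collide

    A level [A] is the interval [[l A, l A + len A)] inside one interval of
    continuity, with index [s A] and translation [g (s A)].  The interval
    [[a, b)] is tiled by the bottom levels, of which only the leftmost [first]
    and the rightmost [last] are named. *)
Section Rigidity.
Variables (R : realFieldType) (Lv : finType).
Variables (l len : Lv -> R) (s : Lv -> nat) (g : nat -> R) (a b : R).
Variables (first last : Lv).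

Local Notation e A := (l A + len A).

Definition outside (A : Lv) := e A <= a \/ b <= l A.

(** A level either moves up to a level outside [[a, b)], or its image falls into
    [[a, b)]; [H] is the velocity of the levels, and what is inside [[a, b)] is
    at rest. *)
Definition level_step (H : Lv -> R) (w : nat -> R) (A : Lv) :=
  (exists A', [/\ outside A', l A' = l A + g (s A), len A' = len A &
                  H A' = H A + w (s A)]) \/
  [/\ a <= l A + g (s A), e A + g (s A) <= b & H A + w (s A) = 0].

Definition adjacent A B := e A <= l B /\ forall C, ~ (e A <= l C /\ e C <= l B).

Hypothesis len_gt0 : forall A, 0 < len A.
Hypothesis disj : forall A B, A != B -> e A <= l B \/ e B <= l A.
Hypothesis s_mono : forall A B, e A <= l B -> (s A <= s B)%N.
Hypothesis l_first : l first = a.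
Hypothesis e_last : e last = b.
Hypothesis acyclic : forall n (f : nat -> Lv), (0 < n)%N ->
  \sum_(j < n) g (s (f j)) != 0.

(** If some level caught up with a level on its right, consider a pair that does
    so at the earliest time [t].  Such a pair is adjacent, hence has equal
    indices by the assumption on thresholds, hence its image is again such a
    pair.  When the image of [A] has fallen into [[a, b)] at rest, it can only
    block the way from the position of [last], which then takes its place;
    symmetrically for [B] and [first].  In all cases the right end of the left
    level moves by [g (s A)], and finiteness contradicts [acyclic]. *)
Lemma no_collision (H : Lv -> R) (w : nat -> R) :
  H first = 0 -> H last = 0 -> (forall A, level_step H w A) ->
  (forall A B, (s A < s B)%N -> adjacent A B -> H A = H B) ->
  forall A B, e A <= l B -> H A <= H B.
Proof.
move=> Hf Hl step thr A0 B0 AB0; rewrite leNgt; apply/negP => HAB0.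
pose closing (p : Lv * Lv) := (e p.1 <= l p.2) && (H p.2 < H p.1).
pose time (p : Lv * Lv) := (l p.2 - e p.1) / (H p.1 - H p.2).
have [[A1 B1] /andP[/= c1 c1'] tmin] : exists2 p, closing p &
    forall q, closing q -> time p <= time q.
  by apply: exists_fin_min; exists (A0, B0); rewrite /closing/= AB0.
set t := time (A1, B1) in tmin.
have tle A B : e A <= l B -> H B < H A -> t * (H A - H B) <= l B - e A.
  move=> AB HAB; have := tmin (A, B); rewrite /closing /= AB HAB => /(_ isT).
  by rewrite ler_pdivlMr ?subr_gt0.
(* [M p]: the pair [p] collides at the time [t], stated without a quotient *)
pose M (p : Lv * Lv) := [&& e p.1 <= l p.2, H p.2 < H p.1 &
   l p.2 - e p.1 == t * (H p.1 - H p.2)].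
have t_ge0 : 0 <= t.
  by rewrite /t /time /= divr_ge0 ?subr_ge0 // ltW.
have Ms p : M p -> s p.1 = s p.2.
  case: p => A B /and3P[/= AB HAB /eqP eAB].
  apply/eqP; rewrite eqn_leq s_mono //= leqNgt; apply/negP => sAB.
  suff : H A = H B by move=> E; rewrite E ltxx in HAB.
  apply: thr => //; split=> // C [AC CB]; have lC := len_gt0 C.
  have [h1|h1] := ltP (H C) (H A); have [h2|h2] := ltP (H B) (H C).
  - by have := tle _ _ AC h1; have := tle _ _ CB h2; nra.
  - by have := tle _ _ AC h1; nra.
  - by have := tle _ _ CB h2; nra.
  - by move: (lt_le_trans HAB h1) => /lt_le_trans /(_ h2); rewrite ltxx.
have next p : M p -> exists q, M q && (e q.1 == e p.1 + g (s p.1)).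
  case: p => A B Mp; have sAB := Ms _ Mp; move: Mp sAB.
  rewrite /M /= => /and3P[AB HAB /eqP eAB] sAB.
  have lA := len_gt0 A; have lB := len_gt0 B.
  case: (step A); case: (step B); rewrite -sAB.
  - move=> [B' [oB' lB' nB' HB']] [A' [oA' lA' nA' HA']].
    exists (A', B'); rewrite /= lB' lA' nA' HB' HA'.
    apply/andP; split; last by apply/eqP; ring.
    apply/and3P; split; [lra|lra|apply/eqP].
    transitivity (l B - (l A + len A)); first by ring.
    by rewrite eAB; congr (t * _); ring.
  - move=> [aB Bb HB'] [A' [oA' lA' nA' HA']]; exists (A', first).
    have HA0 : 0 < H A' by lra.
    have eA' : e A' = e A + g (s A) by rewrite lA' nA'; ring.
    have A'a : e A' <= a by case: oA' => //; lra.
    have := @tle A' first; rewrite l_first Hf eA' => tl.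
    have {}tl : t * (H A' - 0) <= a - (e A + g (s A)) by apply: tl => //; lra.
    have E : l B - (l A + len A) = t * H A' by rewrite eAB; congr (t * _); lra.
    have aA : e A + g (s A) <= a by lra.
    rewrite /= HA0 aA eqxx andbT /= subr0.
    apply/eqP; lra.
  - move=> [B' [oB' lB' nB' HB']] [aA Ab HA']; exists (last, B').
    have HB0 : H B' < 0 by lra.
    have bB' : b <= l B' by case: oB' => //; lra.
    have := @tle last B'; rewrite e_last Hl => tl.
    have {}tl : t * (0 - H B') <= l B' - b by apply: tl => //; lra.
    have E : l B - (l A + len A) = t * (0 - H B').
      by rewrite eAB; congr (t * _); lra.
    rewrite /= HB0 bB' /=.
    by apply/andP; split; apply/eqP; lra.
  - by move=> [_ _ HB] [_ _ HA]; lra.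
pose f p := if [pick q | M q && (e q.1 == e p.1 + g (s p.1))] is Some q then q else p.
have fP p : M p -> M (f p) /\ e (f p).1 = e p.1 + g (s p.1).
  move=> /next[q Mq]; rewrite /f; case: pickP => [u /andP[Mu /eqP]//|/(_ q)].
  by rewrite Mq.
have M1 : M (A1, B1).
  by rewrite /M /= c1 c1' /= /t /time /= divfK // subr_eq0 gt_eqF.
have Mn n : M (iter n f (A1, B1)).
  by elim: n => //= n IH; have [] := fP _ IH.
have sumE i n : e (iter (n + i) f (A1, B1)).1 =
    e (iter i f (A1, B1)).1 + \sum_(j < n) g (s (iter (j + i) f (A1, B1)).1).
  elim: n => [|n IH]; first by rewrite big_ord0 addr0.
  rewrite big_ord_recr /= addrA -IH.
  by have [_ ->] := fP _ (Mn (n + i)%N).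
have [i [j [ij eij]]] := iter_fin_cycle f (A1, B1).
have := acyclic (fun k => (iter (k + i) f (A1, B1)).1) (n := (j - i)%N).
rewrite subn_gt0 => /(_ ij) /eqP; apply.
have := sumE i (j - i)%N; rewrite subnK ?(ltnW ij)// -eij.
by move=> E; apply: (addrI (e (iter i f (A1, B1)).1)); rewrite -E addr0.
Qed.

(** Both [H] and [- H] are monotone from left to right, so [H] is constant. *)
Lemma levels_rigid (H : Lv -> R) (w : nat -> R) :
  H first = 0 -> H last = 0 -> (forall A, level_step H w A) ->
  (forall A B, (s A < s B)%N -> adjacent A B -> H A = H B) ->
  forall A, H A = 0.
Proof.
move=> Hf Hl step thr.
have le1 := no_collision Hf Hl step thr.
have le2 A B : e A <= l B -> - H A <= - H B.
  apply: (@no_collision (fun A => - H A) (fun i => - w i)) => //.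
  - by rewrite Hf oppr0.
  - by rewrite Hl oppr0.
  - move=> C; case: (step C) => [[A' [? ? ? E]]|[? ? E]]; [left|right].
      by exists A'; split=> //; rewrite E opprD.
    by split => //; rewrite -opprD E oppr0.
  - by move=> C D sCD aCD; rewrite (thr C D).
have eqH A B : e A <= l B -> H A = H B.
  by move=> AB; apply/eqP; rewrite eq_le le1 //= -lerN2 le2.
move=> A; have [->//|/disj[] /eqH E] := eqVneq A first.
  by rewrite E.
by rewrite -E.
Qed.
End Rigidity.

Lemma exists_orthogonal (F : fieldType) (C : finType) r (q : C -> nat -> F) :
  (#|C| < r)%N -> exists w : nat -> F,
    (exists2 i, (i < r)%N & w i != 0) /\
    forall c, \sum_(i < r) w i * q c i = 0.
Proof.
move=> Cr; pose M : 'M[F]_(r, #|C|) := \matrix_(i, j) q (enum_val j) i.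
have : kermx M != 0.
  rewrite -mxrank_eq0 mxrank_ker subn_eq0 -ltnNge.
  exact: leq_ltn_trans (rank_leq_col M) Cr.
move=> /rowV0Pn[v /sub_kermxP vM /rV0Pn[i vi]].
exists (fun i => if insub i is Some j then v 0 j else 0); split.
  by exists i => //=; rewrite valK.
move=> c; move/matrixP: vM => /(_ 0 (enum_rank c)); rewrite !mxE => E.
rewrite -[RHS]E; apply: eq_bigr => j _.
by rewrite valK mxE enum_rankK.
Qed.

(** Remove the rightmost interval and argue by induction on their number. *)
Lemma sum_disjoint_le (R : realFieldType) (I : finType) (l len : I -> R) (c d : R) :
  c <= d -> (forall i, 0 < len i) -> (forall i, c <= l i) ->
  (forall i, l i + len i <= d) ->
  (forall i j, i != j -> l i + len i <= l j \/ l j + len j <= l i) ->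
  \sum_i len i <= d - c.
Proof.
move=> cd len0 cl ld disj.
suff H n : forall (A : {set I}) d, #|A| = n -> c <= d ->
    (forall i, i \in A -> l i + len i <= d) -> \sum_(i in A) len i <= d - c.
  rewrite (eq_bigl (mem [set: I])%SET) => [|i]; last by rewrite !inE.
  exact: (H #|[set: I]%SET|).
elim: n => [|n IH] A {ld}d cA {}cd ld.
  by move/eqP: cA; rewrite cards_eq0 => /eqP->; rewrite big_set0 subr_ge0.
have [i iA imax] : exists2 i, i \in A & forall j, j \in A -> - l i <= - l j.
  by apply: exists_fin_min; apply/set0Pn; rewrite -card_gt0 cA.
rewrite (big_setD1 i) //=; move: cA; rewrite (cardsD1 i) iA add1n => -[cA].
have {}IH : \sum_(j in (A :\ i)%SET) len j <= l i - c.
  apply: IH => // j; rewrite !inE => /andP[ji jA].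
  by have := imax _ jA; have := len0 i; case: (disj _ _ ji) => //; lra.
by have := ld _ iA; lra.
Qed.

(** * Itineraries and integral relations

    [indep] is non-resonance.  The set [X] is invariant under [T], which is
    injective on it; it stands for the attractor. *)
Section Dynamics.
Variables (R : realType) (r : nat) (beta gamma : nat -> R) (T : R -> R).
Hypothesis beta0 : beta 0%N = 0.
Hypothesis betar : beta r = 1.
Hypothesis beta_lt : forall i, (i < r)%N -> beta i < beta i.+1.
Hypothesis TE : forall i x, (i < r)%N -> beta i <= x < beta i.+1 -> T x = x + gamma i.
Hypothesis indep : forall n m : nat -> int,
  \sum_(i < r) (n i)%:~R * gamma i + \sum_(i < r | (0 < i)%N) (m i)%:~R * beta i = 0 ->
  (forall i, (i < r)%N -> n i = 0) /\ (forall i, (0 < i < r)%N -> m i = 0).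

Definition letter (x : R) := find (fun i => x < beta i.+1) (iota 0 r).

Lemma beta_le i j : (i <= j <= r)%N -> beta i <= beta j.
Proof.
elim: j => [|j IH]; first by rewrite leqn0 => /andP[/eqP->].
move=> /andP[]; rewrite leq_eqVlt => /predU1P[->//|ij] jr.
by rewrite (le_trans (IH _)) ?ltW ?beta_lt// -ltnS ij ltnW.
Qed.

Lemma letterP x : 0 <= x < 1 ->
  (letter x < r)%N /\ beta (letter x) <= x < beta (letter x).+1.
Proof.
move=> /andP[x0 x1].
have r0 : (0 < r)%N.
  by rewrite lt0n; apply/eqP => e; move: betar; rewrite e beta0; lra.
have hs : has (fun i => x < beta i.+1) (iota 0 r).
  by apply/hasP; exists r.-1; rewrite ?mem_iota ?add0n /= ?prednK// betar.
have lr : (letter x < r)%N by move: hs; rewrite has_find size_iota.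
split=> //; have := nth_find 0%N hs; rewrite -/(letter x) nth_iota// add0n => ->.
rewrite andbT; case E : (letter x) => [|k]; first by rewrite beta0.
have kl : (k < letter x)%N by rewrite E.
by have := before_find 0%N kl; rewrite nth_iota ?add0n ?(ltn_trans kl)// leNgt => ->.
Qed.

Lemma letter_eq i x : (i < r)%N -> beta i <= x < beta i.+1 -> letter x = i.
Proof.
move=> ir /andP[ix xi].
have x01 : 0 <= x < 1.
  have := @beta_le 0%N i; rewrite beta0 leq0n ltnW// => /(_ isT).
  have := @beta_le i.+1 r; rewrite betar leqnn ir => /(_ isT).
  by lra.
have [lr /andP[lx xl]] := letterP x01.
case: (ltngtP (letter x) i) => // h; exfalso.
  have := @beta_le (letter x).+1 i; rewrite h ltnW// => /(_ isT); lra.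
have := @beta_le i.+1 (letter x); rewrite h ltnW// => /(_ isT); lra.
Qed.

Lemma letter_ge i x : (i < r)%N -> beta i <= x < 1 -> (i <= letter x)%N.
Proof.
move=> ir /andP[ix x1]; have i0 := @beta_le 0%N i.
rewrite beta0 leq0n ltnW // in i0; have {}i0 := i0 isT.
have [|lr /andP[lx xl]] := @letterP x; first by lra.
rewrite leqNgt; apply/negP => h.
by have := @beta_le (letter x).+1 i; rewrite h ltnW// => /(_ isT); lra.
Qed.

Lemma letter_mono x y : 0 <= x -> x <= y -> y < 1 -> (letter x <= letter y)%N.
Proof.
move=> x0 xy y1; have [|lr /andP[lx xl]] := @letterP x; first by lra.
by apply: letter_ge => //; lra.
Qed.

Variable X : set R.
Hypothesis X01 : forall x, X x -> 0 <= x < 1.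
Hypothesis XT : forall x, X x -> X (T x).
Hypothesis Tinj : forall x y, X x -> X y -> T x = T y -> x = y.

Lemma TXE x : X x -> T x = x + gamma (letter x).
Proof. by move=> /X01 /letterP[? ?]; exact: TE. Qed.

Lemma XiterT k x : X x -> X (iter k T x).
Proof. by move=> Xx; elim: k => //= k; exact: XT. Qed.

Lemma iterT_inj k x y : X x -> X y -> iter k T x = iter k T y -> x = y.
Proof.
move=> Xx Xy; elim: k => //= k IH /Tinj E; apply: IH; apply: E; exact: XiterT.
Qed.

(** Birkhoff sum of a function of the letter; with [w := gamma] it is the
    displacement of [x] after [k] steps. *)
Definition along (w : nat -> R) (x : R) (k : nat) :=
  \sum_(j < k) w (letter (iter j T x)).

Lemma alongS w x k : along w x k.+1 = along w x k + w (letter (iter k T x)).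
Proof. by rewrite /along big_ord_recr. Qed.

Lemma iterTE k x : X x -> iter k T x = x + along gamma x k.
Proof.
move=> Xx; elim: k => [|k IH]; first by rewrite /along big_ord0 addr0.
by rewrite alongS addrA -IH /= TXE //; exact: XiterT.
Qed.

(** The abelianised itinerary of [x]. *)
Definition visits x k i : nat := \sum_(j < k) (letter (iter j T x) == i).

Lemma along_visits w x k : X x ->
  along w x k = \sum_(i < r) (visits x k i)%:R * w i.
Proof.
move=> Xx; elim: k => [|k IH].
  rewrite /along big_ord0 big1// => i _.
  by rewrite /visits big_ord0 mul0r.
rewrite alongS IH; have [lr _] := letterP (X01 (XiterT k Xx)).
transitivity (\sum_(i < r) ((visits x k i)%:R * w i +
    (letter (iter k T x) == i)%:R * w i)).
  rewrite big_split /=; congr (_ + _).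
  rewrite (bigD1 (Ordinal lr)) //= eqxx mul1r big1 ?addr0// => i /negPf.
  by rewrite -val_eqE /= eq_sym => ->; rewrite mul0r.
by apply: eq_bigr => i _; rewrite /visits big_ord_recr natrD mulrDl.
Qed.

Lemma visits_total x k : X x -> (\sum_(i < r) visits x k i)%N = k.
Proof.
move=> Xx; rewrite /visits exchange_big /= -[RHS](card_ord k) -sum1_card.
apply: eq_bigr => j _; have [lr _] := letterP (X01 (XiterT j Xx)).
rewrite (bigD1 (Ordinal lr)) //= eqxx big1 // => i /negPf.
by rewrite -val_eqE /= eq_sym => ->.
Qed.

(** Moving every [gamma_i] with velocity [w i] and every [beta_i] with velocity
    [v i] moves each integral combination [z] of them; [z] is killed when its
    velocity vanishes.  By [indep] the coefficients are determined by [z], but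
    stating existence suffices and makes this an additive subgroup. *)
Definition killed (w v : nat -> R) (z : R) := exists n m : nat -> int,
  z = \sum_(i < r) (n i)%:~R * gamma i + \sum_(i < r | (0 < i)%N) (m i)%:~R * beta i /\
  \sum_(i < r) (n i)%:~R * w i + \sum_(i < r | (0 < i)%N) (m i)%:~R * v i = 0.

Lemma killedB w v x y : killed w v x -> killed w v y -> killed w v (x - y).
Proof.
move=> [n [m [-> E]]] [n' [m' [-> E']]].
exists (fun i => n i - n' i), (fun i => m i - m' i).
have H (u z : nat -> R) : \sum_(i < r) (n i - n' i)%:~R * u i +
    \sum_(i < r | (0 < i)%N) (m i - m' i)%:~R * z i =
  (\sum_(i < r) (n i)%:~R * u i + \sum_(i < r | (0 < i)%N) (m i)%:~R * z i) -
  (\sum_(i < r) (n' i)%:~R * u i + \sum_(i < r | (0 < i)%N) (m' i)%:~R * z i).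
  rewrite opprD addrACA -!sumrB; congr (_ + _);
    by apply: eq_bigr => i _; rewrite rmorphB mulrBl.
by rewrite !H E E' subrr.
Qed.

Lemma killed0 w v : killed w v 0.
Proof.
by exists (fun=> 0), (fun=> 0); rewrite !big1 ?addr0 // => i _; rewrite mul0r.
Qed.

Lemma killedD w v x y : killed w v x -> killed w v y -> killed w v (x + y).
Proof.
move=> kx ky; rewrite -[y]opprK -[- y]add0r; apply: killedB => //.
by apply: killedB => //; exact: killed0.
Qed.

Lemma killed_along w v x k : X x -> along w x k = 0 -> killed w v (along gamma x k).
Proof.
move=> Xx; rewrite !along_visits// => E.
exists (fun i => (visits x k i)%:Z), (fun=> 0).
rewrite [X in _ = _ + X]big1 ?addr0; last by move=> i _; rewrite mul0r.
rewrite [X in _ + X = _]big1 ?addr0; last by move=> i _; rewrite mul0r.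
by split.
Qed.

(** This is where non-resonance is used: the coefficients witnessing that a
    displacement is killed have to be those of the itinerary. *)
Lemma along_killed w v x k : X x -> killed w v (along gamma x k) -> along w x k = 0.
Proof.
move=> Xx [n [m []]]; rewrite !along_visits// => E E0.
have := @indep (fun i => (visits x k i)%:Z - n i) (fun i => - m i).
case.
  transitivity (\sum_(i < r) (visits x k i)%:R * gamma i -
     (\sum_(i < r) (n i)%:~R * gamma i + \sum_(i < r | (0 < i)%N) (m i)%:~R * beta i));
    last by rewrite E subrr.
  rewrite opprD addrA -sumrB -sumrN; congr (_ + _); apply: eq_bigr => i _.
    by rewrite rmorphB mulrBl.
  by rewrite rmorphN mulNr.
move=> hn hm; rewrite -[RHS]E0.
rewrite [X in _ = _ + X]big1 ?addr0; last first.
  move=> i i0; have := hm i; rewrite i0 ltn_ord => /(_ isT) /eqP.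
  by rewrite oppr_eq0 => /eqP->; rewrite mul0r.
apply: eq_bigr => i _; have /eqP := hn i (ltn_ord i).
by rewrite subr_eq0 => /eqP <-.
Qed.

Lemma killed_beta w v x k i : X x -> (0 < i < r)%N -> iter k T x = beta i ->
  v i = along w x k -> killed w v x.
Proof.
move=> Xx /andP[i0 ir] xi vi.
exists (fun j => - (visits x k j)%:Z), (fun j => (j == i)%:Z).
have H (u z : nat -> R) : \sum_(j < r) (- (visits x k j)%:Z)%:~R * u j +
   \sum_(j < r | (0 < j)%N) ((j : nat) == i)%:Z%:~R * z j = z i - along u x k.
  rewrite addrC (bigD1 (Ordinal ir)) //= eqxx mul1r big1 ?addr0.
    congr (_ + _); rewrite along_visits // -sumrN; apply: eq_bigr => j _.
    by rewrite rmorphN mulNr.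
  by move=> j /andP[_]; rewrite -val_eqE /= => /negPf ->; rewrite mul0r.
by rewrite !H vi subrr -xi iterTE // addrK.
Qed.

(** By [indep] each letter would occur zero times. *)
Lemma acyclic (n : nat) (f : nat -> nat) : (0 < n)%N ->
  (forall j, (f j < r)%N) -> \sum_(j < n) gamma (f j) != 0.
Proof.
move=> n0 fr; apply/eqP => E.
have := @indep (fun i => \sum_(j < n) (f j == i)%:Z) (fun=> 0); case.
  rewrite [X in _ + X]big1 ?addr0; last by move=> i _; rewrite mul0r.
  rewrite -[RHS]E; under eq_bigr do rewrite rmorph_sum /= mulr_suml.
  rewrite exchange_big /=; apply: eq_bigr => j _.
  rewrite (bigD1 (Ordinal (fr j))) //= eqxx mul1r big1 ?addr0// => i.
  by rewrite -val_eqE /= eq_sym => /negPf ->; rewrite mul0r.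
move=> /(_ _ (fr 0%N)) h _; move: h; rewrite (bigD1 (Ordinal n0)) //= eqxx => h.
suff : (1 : int) <= 0 by [].
by rewrite -[leRHS]h lerDl; exact: sumr_ge0.
Qed.

Lemma along_neq0 x k : X x -> (0 < k)%N -> along gamma x k != 0.
Proof.
move=> Xx k0; apply: (@acyclic k (fun j => letter (iter j T x))) => // j.
by have [] := letterP (X01 (XiterT j Xx)).
Qed.

(** * Flowing a part of a component until it returns

    [[a, b)] is a component of [X]; its maximality is used through [Jmax]. *)
Section Component.
Variables a b : R.
Hypothesis ab : a < b.
Hypothesis JX : forall x, a <= x < b -> X x.
Hypothesis Jmax : forall u v, u < v -> (forall x, u <= x < v -> X x) ->
  [\/ v <= a, a <= u /\ v <= b | b <= u].

Definition inJ x := a <= x < b.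

(** The breakpoints of the first return map to [[a, b)] are the points [x] with
    [hit i x k] for some [k] and [0 < i < r]. *)
Definition hit i x k := [/\ a < x < b, iter k T x = beta i &
  forall j, (0 < j <= k)%N -> ~~ inJ (iter j T x)].

(** Two orbits that start in [[a, b)] and meet are the same orbit, one of them
    delayed; the delay is zero unless the other one returned meanwhile. *)
Lemma coincide x x' k k' : inJ x -> inJ x' -> (k <= k')%N ->
  iter k T x = iter k' T x' -> ((0 < k' - k)%N -> ~~ inJ (iter (k' - k) T x')) ->
  k = k' /\ x = x'.
Proof.
move=> Jx Jx' kk' + out; rewrite -(subnKC kk') iterD => /iterT_inj E.
have {}E : x = iter (k' - k) T x' by apply: E; [|apply: XiterT]; exact: JX.
case: (posnP (k' - k)) out E => [d0 _|d0 /(_ isT) + E]; last by rewrite -E Jx.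
by rewrite d0 /= addn0.
Qed.

Lemma hit_inj i x x' k k' : hit i x k -> hit i x' k' -> x = x' /\ k = k'.
Proof.
wlog kk' : x x' k k' / (k <= k')%N => [W h h'|].
  case/orP: (leq_total k k') => [/W|/W]; first by apply.
  by case/(_ _ _ h' h).
move=> [/andP[ax xb] xi _] [/andP[ax' xb'] xi' out].
have Jx : inJ x by apply/andP; lra.
have Jx' : inJ x' by apply/andP; lra.
case: (coincide Jx Jx' kk'); rewrite ?xi ?xi'// => d0.
by apply: out; rewrite d0 leq_subr.
Qed.

(** No interior point of [[u, v)] reaches a discontinuity before time [k]
    without having returned. *)
Definition unbroken u v k := [/\ a <= u, u < v, v <= b &
  forall x j i, u < x < v -> (j < k)%N -> (0 < i < r)%N -> ~ hit i x j].

Definition away x k := forall j, (0 < j < k)%N -> ~~ inJ (iter j T x).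

Lemma unbrokenJ u v k x : unbroken u v k -> u <= x < v -> inJ x.
Proof. by case=> au uv vb _ /andP[ux xv]; rewrite /inJ; apply/andP; split; lra. Qed.

Lemma shift_place u v k : unbroken u v k ->
  (forall x, u <= x < v -> iter k T x = iter k T u + (x - u)) ->
  [\/ iter k T u + (v - u) <= a,
      a <= iter k T u /\ iter k T u + (v - u) <= b | b <= iter k T u].
Proof.
move=> ub E; have [au uv vb _] := ub; apply: Jmax; first lra.
move=> z zz; have := E (u + (z - iter k T u)).
rewrite [X in _ = X](_ : _ = z); last by ring.
move=> <-; last by apply/andP; lra.
by apply/XiterT/JX/(unbrokenJ ub)/andP; lra.
Qed.

(** An unbroken interval moves rigidly as long as its left end stays away: if two
    of its points had different letters, the point between them that is mapped
    to the separating discontinuity would be a hit. *)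
Lemma flow u v k : unbroken u v k -> away u k -> forall x, u <= x < v ->
  [/\ iter k T x = iter k T u + (x - u),
      forall j, (j < k)%N -> letter (iter j T x) = letter (iter j T u) &
      away x k].
Proof.
elim: k => [|k IH] ub aw.
  by move=> x _; split=> [|//|j]; [rewrite /=; ring|rewrite ltn0 andbF].
have [au uv vb nb] := ub.
have ubk : unbroken u v k by split=> // x j i ? /ltnW; exact: nb.
have {}IH x : u <= x < v -> [/\ iter k T x = iter k T u + (x - u),
      forall j, (j < k)%N -> letter (iter j T x) = letter (iter j T u) &
      away x k].
  move=> xuv; apply: IH => // j /andP[j0 jk]; apply: aw.
  by rewrite j0 ltnW.
have awk x : u <= x < v -> away x k.+1.
  move=> xuv j /andP[j0]; rewrite ltnS leq_eqVlt => /predU1P[jk|jk]; last first.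
    by have [_ _] := IH x xuv; apply; rewrite j0.
  have [E _ _] := IH x xuv; subst j.
  have /aw : (0 < k < k.+1)%N by rewrite j0 /=.
  have := shift_place ubk (fun x xuv => let: And3 h _ _ := IH x xuv in h).
  rewrite /inJ E; move/andP: xuv => [ux xv].
  by case=> [h|[h1 h2]|h]; rewrite ?negb_and -?ltNge -?leNgt => H;
    apply/orP; try (case/orP: H => H); lra.
have same x : u <= x < v -> letter (iter k T x) = letter (iter k T u).
  move=> xuv; have [E _ _] := IH x xuv; have /andP[ux xv] := xuv.
  have Xu : X (iter k T u) by apply/XiterT/JX/(unbrokenJ ub); rewrite lexx uv.
  have Xx : X (iter k T x) by apply/XiterT/JX/(unbrokenJ ub).
  apply/eqP; rewrite eqn_leq; have /andP[u0 u1] := X01 Xu.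
  have /andP[x0 x1] := X01 Xx.
  rewrite [X in _ && X]letter_mono // ?E ?lerDl ?subr_ge0 // -?E //.
  rewrite andbT leqNgt; apply/negP => lt.
  have [lr /andP[lx xl]] := letterP (X01 Xx).
  set i := letter (iter k T x) in lt lr lx xl.
  have iu : iter k T u < beta i.
    rewrite ltNge; apply/negP => h; suff : (i <= letter (iter k T u))%N by rewrite leqNgt lt.
    by apply: letter_ge => //; rewrite h.
  pose x' := u + (beta i - iter k T u).
  have x'uv : u <= x' < v by rewrite /x'; apply/andP; lra.
  have x'uv' : u < x' < v by rewrite /x'; apply/andP; lra.
  apply: (nb x' k i) => //; first by rewrite lr (leq_trans _ lt).
  split.
  - by move/andP: x'uv' => [? ?]; apply/andP; lra.
  - by have [-> _ _] := IH x' x'uv; rewrite /x'; ring.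
  - by move=> j; exact: awk.
move=> x xuv; have [E l _] := IH x xuv; split; last exact: awk.
  have Xu : X (iter k T u) by apply/XiterT/JX/(unbrokenJ ub); rewrite lexx uv.
  have Xx : X (iter k T x) by apply/XiterT/JX/(unbrokenJ ub).
  by rewrite !iterS !TXE // same // E; ring.
by move=> j; rewrite ltnS leq_eqVlt => /predU1P[->|/l//]; exact: same.
Qed.

(** At each time the interval is a connected part of [X], so it lies inside
    [[a, b)] or beside it: its points return simultaneously. *)
Lemma flow_place u v k : unbroken u v k -> away u k ->
  [\/ iter k T u + (v - u) <= a,
      a <= iter k T u /\ iter k T u + (v - u) <= b | b <= iter k T u].
Proof.
by move=> ub aw; apply: shift_place => // x /(flow ub aw)[].
Qed.

Lemma flow_disjoint u v k u' v' k' : unbroken u v k -> away u k ->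
  unbroken u' v' k' -> away u' k' -> [\/ v <= u', v' <= u | k != k'] ->
  (0 < k)%N \/ away u' k'.+1 -> (0 < k')%N \/ away u k.+1 ->
  iter k T u + (v - u) <= iter k' T u' \/ iter k' T u' + (v' - u') <= iter k T u.
Proof.
wlog kk' : u v k u' v' k' / (k <= k')%N => [W ub aw ub' aw' ne h h'|].
  case/orP: (leq_total k k') => kk'; first exact: W.
  apply/or_comm; apply: W => //.
  by case: ne; [constructor 2|constructor 1|rewrite eq_sym; constructor 3].
move=> ub aw ub' aw' ne h _; have [_ uv _ _] := ub; have [_ uv' _ _] := ub'.
apply: contrapT => /not_orP[/negP + /negP]; rewrite -!ltNge => n1 n2.
pose z := Num.max (iter k T u) (iter k' T u').
have [zu zu'] : iter k T u <= z /\ iter k' T u' <= z.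
  by rewrite /z !le_max !lexx orbT.
have [zv zv'] : z < iter k T u + (v - u) /\ z < iter k' T u' + (v' - u').
  by rewrite /z !gt_max; split; apply/andP; lra.
pose x := u + (z - iter k T u); pose x' := u' + (z - iter k' T u').
have xuv : u <= x < v by rewrite /x; apply/andP; lra.
have xuv' : u' <= x' < v' by rewrite /x'; apply/andP; lra.
have [E _ _] := flow ub aw xuv; have [E' _ awx'] := flow ub' aw' xuv'.
have [] := coincide (unbrokenJ ub xuv) (unbrokenJ ub' xuv') kk'.
- by rewrite E E' /x /x'; ring.
- move=> d0; case: h => [k0|aw''].
    by apply: awx'; rewrite d0 /= -subn_gt0 subKn.
  have [k0|k0] := posnP k; last by apply: awx'; rewrite d0 /= -subn_gt0 subKn.
  have k'0 : (0 < k')%N by rewrite k0 subn0 in d0.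
  have := aw'' k'; rewrite k'0 ltnSn k0 subn0 => /(_ isT).
  have := flow_place ub' aw'; rewrite /inJ E'; move/andP: xuv' => [? ?].
  by case=> [?|[? ?]|?]; rewrite ?negb_and -?ltNge -?leNgt => H;
    apply/orP; try (case/orP: H => H); lra.
- move=> kE xE; move/andP: xuv => [? ?]; move/andP: xuv' => [? ?].
  by case: ne => [?|?|]; [lra|lra|rewrite kE eqxx].
Qed.

(** Otherwise the images of [[u, v)] would be infinitely many disjoint intervals
    of the same length in [[0, 1)]. *)
Lemma returns u v : a <= u -> u < v -> v <= b ->
  (forall x j i, u < x < v -> (0 < i < r)%N -> ~ hit i x j) ->
  exists k, (0 < k)%N && inJ (iter k T u).
Proof.
move=> au uv vb nb; apply: contrapT => no.
have aw k : away u k.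
  move=> j /andP[j0 _]; apply/negP => Jj; apply: no; exists j.
  by rewrite j0.
have ub k : unbroken u v k by split=> // x j i ? _; exact: nb.
pose N := (Num.truncn (v - u)^-1).+1.
have := @sum_disjoint_le R 'I_N (fun j => iter j T u) (fun=> v - u) 0 1.
rewrite sumr_const card_ord subr0 -mulr_natr => H.
have XJ k x : u <= x < v -> X (iter k T x).
  by move=> xuv; apply/XiterT/JX/(unbrokenJ (ub 0%N)).
have uu : u <= u < v by rewrite lexx.
have : (v - u) * N%:R <= 1.
  apply: H => //.
  - by move=> _; rewrite subr_gt0.
  - by move=> k; have /andP[] := X01 (XJ k u uu).
  - move=> k; rewrite leNgt; apply/negP => h.
    have /andP[u0 u1] := X01 (XJ k u uu).
    pose x := u + (1 - iter k T u).
    have xuv : u <= x < v by rewrite /x; apply/andP; lra.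
    have [E _ _] := flow (ub k) (aw k) xuv.
    by have := X01 (XJ k x xuv); rewrite E /x; lra.
  - move=> i j ij; apply: flow_disjoint => //; last by right.
    + by constructor 3.
    + by right.
rewrite mulrC -ler_pdivlMr ?subr_gt0// div1r leNgt; apply/negP; rewrite negbK.
by rewrite /N; exact: truncnS_gt.
Qed.

(** * Columns and tiles of the first return map *)

Definition hitp : pred 'I_r :=
  fun i => (0 < i)%N && `[< exists x k, hit i x k >].

Definition hit_place (i : nat) : R * nat := xget (a, 0%N) [set p | hit i p.1 p.2].

Lemma hit_placeP i x k : hit i x k -> hit_place i = (x, k).
Proof.
move=> h; rewrite /hit_place; case: xgetP => [[x' k'] _ /=|/(_ (x, k))//].
by case/(hit_inj h) => -> ->.
Qed.

(** The left ends of the columns: [a] and the breakpoints. *)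
Definition cuts : seq R :=
  sort <=%O (a :: undup [seq (hit_place (val i)).1 | i <- enum hitp]).

Definition ncol := size cuts.

(** The default value makes [cut ncol] the right end [b]. *)
Definition cut c := nth b cuts c.

Lemma mem_cutsP x : reflect (x = a \/ exists i k, (0 < i < r)%N /\ hit i x k) (x \in cuts).
Proof.
rewrite /cuts mem_sort inE mem_undup; apply: (iffP orP).
  case=> [/eqP|/mapP[i]]; first by left.
  rewrite mem_enum => /andP[i0 /asboolP[x' [k hi]]] ->.
  by right; exists i, k; rewrite (hit_placeP hi) i0 ltn_ord.
case=> [->|[i [k [/andP[i0 ir] hi]]]]; first by left; rewrite eqxx.
right; apply/mapP; exists (Ordinal ir); last by rewrite /= (hit_placeP hi).
by rewrite mem_enum unfold_in /hitp /= i0; apply/asboolP; exists x, k.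
Qed.

Lemma cuts_in x : x \in cuts -> a <= x < b.
Proof.
case/mem_cutsP => [->|[i [k [_ [/andP[ax xb] _ _]]]]]; first by rewrite lexx.
by rewrite ltW.
Qed.

Lemma cuts_sorted : sorted <%O cuts.
Proof.
rewrite lt_sorted_uniq_le sort_sorted ?andbT; last exact: le_total.
rewrite /cuts sort_uniq /= undup_uniq andbT mem_undup; apply/mapP => -[i].
rewrite mem_enum => /andP[_ /asboolP[x [k hi]]]; rewrite (hit_placeP hi) /= => ax.
by case: hi => /andP[]; rewrite -ax ltxx.
Qed.

Lemma cut_mem c : (c < ncol)%N -> cut c \in cuts.
Proof. exact: mem_nth. Qed.

Lemma cut_lt c c' : (c < c' <= ncol)%N -> cut c < cut c'.
Proof.
move=> /andP[cc']; rewrite leq_eqVlt => /predU1P[E|c'n].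
  rewrite E in cc' *; rewrite /cut [ltRHS]nth_default //.
  by have /cuts_in/andP[] := cut_mem cc'.
by apply: (sorted_ltn_nth lt_trans) => //; [exact: cuts_sorted|rewrite inE (ltn_trans cc')].
Qed.

Lemma cut_last : cut ncol = b. Proof. by rewrite /cut nth_default. Qed.

Lemma ncol_gt0 : (0 < ncol)%N. Proof. by rewrite /ncol size_sort. Qed.

Lemma cut_bounds c : a <= cut c <= b.
Proof.
case: (ltnP c ncol) => [/cut_mem/cuts_in/andP[? ?]|h]; first by apply/andP; lra.
by rewrite /cut nth_default // lexx ltW.
Qed.

Lemma cut0 : cut 0%N = a.
Proof.
have acut : a \in cuts by rewrite /cuts mem_sort inE eqxx.
have := cut_bounds 0%N; case/andP=> a0 _; apply/eqP; rewrite eq_le a0 andbT.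
have := nth_index b acut; case: (posnP (index a cuts)) => [-> <-//|i0 E].
by rewrite -[leRHS]E ltW // cut_lt // i0 ltnW // index_mem.
Qed.

(** By [hit_inj] each index [i] contributes at most one breakpoint. *)
Lemma ncol_le : (ncol <= #|hitp|.+1)%N.
Proof.
rewrite /ncol size_sort /= ltnS (leq_trans (size_undup _)) //.
by rewrite size_map cardE.
Qed.

Lemma cut_lt_inv c x : (c < ncol)%N -> cut c < x < cut c.+1 -> x \notin cuts.
Proof.
move=> cn /andP[cx xc]; apply/negP => xin.
have xE : cut (index x cuts) = x by exact: nth_index.
have iN : (index x cuts < ncol)%N by rewrite index_mem.
case: (ltngtP c (index x cuts)) => h.
- have : cut c.+1 <= x.
    move: h; rewrite leq_eqVlt => /predU1P[->|h]; first by rewrite xE.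
    by rewrite -xE ltW // cut_lt // h ltnW.
  lra.
- by have := @cut_lt (index x cuts) c; rewrite h ltnW// => /(_ isT); lra.
- by move: cx; rewrite h xE ltxx.
Qed.

Lemma column_unbroken c k : (c < ncol)%N -> unbroken (cut c) (cut c.+1) k.
Proof.
move=> cn; have /andP[ac _] := cut_bounds c; have /andP[_ cb] := cut_bounds c.+1.
have cc : cut c < cut c.+1 by apply: cut_lt; rewrite ltnSn.
split=> // x j i xc _ ir hi; move/negP: (cut_lt_inv cn xc); apply.
by apply/mem_cutsP; right; exists i, j.
Qed.

Lemma return_exists c : (c < ncol)%N ->
  exists k, [/\ (0 < k)%N, inJ (iter k T (cut c)) & away (cut c) k].
Proof.
move=> cn; have [ac cc cb _] := column_unbroken 0%N cn.
have [|k0 /andP[k0p Jk0]] := returns ac cc cb.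
  by move=> x j i xc ir; have [_ _ _] := column_unbroken j.+1 cn; apply.
have ex : exists k, (0 < k)%N && inJ (iter k T (cut c)) by exists k0; rewrite k0p.
case: (ex_minnP ex) => k /andP[kp Jk] kmin; exists k; split=> //.
by move=> j /andP[j0 jk]; apply/negP => Jj; have := kmin j; rewrite j0 Jj leqNgt jk => /(_ isT).
Qed.

Definition height c : nat := xget 1%N
  [set k | [/\ (0 < k)%N, inJ (iter k T (cut c)) & away (cut c) k]].

Lemma heightP c : (c < ncol)%N ->
  [/\ (0 < height c)%N, inJ (iter (height c) T (cut c)) & away (cut c) (height c)].
Proof. by move=> /return_exists/(xgetPex 1%N). Qed.

Definition width c := cut c.+1 - cut c.
Definition tile c := iter (height c) T (cut c).

Lemma width_gt0 c : (c < ncol)%N -> 0 < width c.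
Proof. by move=> cn; rewrite subr_gt0 cut_lt // ltnSn. Qed.

Lemma tile_in c : (c < ncol)%N -> a <= tile c /\ tile c + width c <= b.
Proof.
move=> cn; have [h0 /andP[aR Rb] aw] := heightP cn.
have := width_gt0 cn; rewrite /width => w0.
by case: (flow_place (column_unbroken _ cn) aw); rewrite /tile; lra.
Qed.

Lemma cut_apart c c' : (c < ncol)%N -> (c' < ncol)%N -> c != c' ->
  cut c.+1 <= cut c' \/ cut c'.+1 <= cut c.
Proof.
have H d d' : (d < d' < ncol)%N -> cut d.+1 <= cut d'.
  move=> /andP[dd' d'n]; move: dd'; rewrite leq_eqVlt => /predU1P[->//|dd'].
  by rewrite ltW // cut_lt // dd' ltnW.
move=> cn c'n; rewrite neq_ltn => /orP[lt|lt]; [left|right]; apply: H;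
  by rewrite lt.
Qed.

Lemma level_disjoint c k c' k' : (c < ncol)%N -> (c' < ncol)%N ->
  (k < height c)%N -> (k' < height c')%N -> (c, k) != (c', k') ->
  iter k T (cut c) + width c <= iter k' T (cut c') \/
  iter k' T (cut c') + width c' <= iter k T (cut c).
Proof.
move=> cn c'n kh kh' ne; have [_ _ aw] := heightP cn; have [_ _ aw'] := heightP c'n.
have sub d j j' : away d j -> (j' <= j)%N -> away d j'.
  by move=> A jj i /andP[i0 ij]; apply: A; rewrite i0 (leq_trans ij).
apply: flow_disjoint; try exact: column_unbroken.
- exact: sub aw (ltnW kh).
- exact: sub aw' (ltnW kh').
- have [cc|cc] := eqVneq c c'; last first.
    by case: (cut_apart cn c'n cc); [constructor 1|constructor 2].
  by constructor 3; apply: contraNneq ne => ->; rewrite cc.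
- by right; exact: sub aw' kh'.
- by right; exact: sub aw kh.
Qed.

Lemma tile_disjoint c c' : (c < ncol)%N -> (c' < ncol)%N -> c != c' ->
  tile c + width c <= tile c' \/ tile c' + width c' <= tile c.
Proof.
move=> cn c'n ne; have [h0 _ aw] := heightP cn; have [h0' _ aw'] := heightP c'n.
apply: flow_disjoint; try exact: column_unbroken; rewrite ?h0 ?h0' //; last 2 first.
- by left.
- by left.
by case: (cut_apart cn c'n ne); [constructor 1|constructor 2].
Qed.

(** The tiles are disjoint in [[a, b)] and have the total length [b - a], so no
    room is left for a further interval. *)
Lemma tiles_cover p q : a <= p -> p < q -> q <= b ->
  exists c, [/\ (c < ncol)%N, p < tile c + width c & tile c < q].
Proof.
move=> ap pq qb; apply: contrapT => no.
have out c : (c < ncol)%N -> tile c + width c <= p \/ q <= tile c.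
  move=> cn; apply: contrapT => /not_orP[/negP + /negP]; rewrite -!ltNge => h1 h2.
  by apply: no; exists c.
pose l (c : 'I_ncol.+1) := if (c < ncol)%N then tile c else p.
pose len (c : 'I_ncol.+1) := if (c < ncol)%N then width c else q - p.
have sumE : \sum_c len c = (b - a) + (q - p).
  rewrite big_ord_recr /= {2}/len /= ltnn; congr (_ + _).
  rewrite -cut_last -cut0 -(telescope_sumr cut (leq0n ncol)) big_mkord.
  by apply: eq_bigr => i _; rewrite /len /= ltn_ord.
suff : \sum_c len c <= b - a by rewrite sumE; lra.
apply: (@sum_disjoint_le R 'I_ncol.+1 l len); rewrite /l /len.
- exact: ltW.
- by move=> c; case: ifP => [/width_gt0//|_]; rewrite subr_gt0.
- by move=> c; case: ifP => [/tile_in[]|].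
- by move=> c; case: ifP => [/tile_in[]//|_]; lra.
- move=> c c'; rewrite -val_eqE /= => ne.
  case: (ltnP c ncol) => cn; case: (ltnP c' ncol) => c'n.
  + exact: tile_disjoint.
  + by rewrite [p + _]addrC subrK; exact: out.
  + by apply/or_comm; rewrite [p + _]addrC subrK; exact: out.
  + move: ne; have := ltn_ord c; have := ltn_ord c'; rewrite !ltnS => h1 h2.
    by rewrite (@anti_leq c ncol) ?h2// (@anti_leq c' ncol) ?h1// eqxx.
Qed.

Lemma tile_before z : a < z -> z <= b ->
  exists c, [/\ (c < ncol)%N, tile c < z & z <= tile c + width c].
Proof.
move=> az zb.
pose M := \big[Num.max/a]_(c < ncol | tile c + width c < z) (tile c + width c).
have Mz : M < z by apply/bigmax_ltP; split=> // i /andP[].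
have aM : a <= M by exact: bigmax_ge_id.
have [c [cn Mc cz]] := tiles_cover aM Mz zb; exists c; split=> //.
rewrite leNgt; apply/negP => lt.
have : tile c + width c <= M by apply: (@le_bigmax_cond _ _ _ _ (Ordinal cn)).
by lra.
Qed.

Lemma cutJ c : (c < ncol)%N -> inJ (cut c).
Proof. by move=> /cut_mem/cuts_in. Qed.

Lemma tileE c : (c < ncol)%N -> tile c = cut c + along gamma (cut c) (height c).
Proof. by move=> /cutJ/JX Xc; exact: iterTE. Qed.

Lemma tile_neq c : (c < ncol)%N -> tile c != cut c.
Proof.
move=> cn; have [h0 _ _] := heightP cn.
rewrite tileE // -subr_eq0 addrAC subrr add0r.
by apply: along_neq0 => //; apply/JX/cutJ.
Qed.

(** The column is not the first one, since [a] is not fixed by the return map. *)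
Lemma first_tile : exists c, [/\ (0 < c)%N, (c < ncol)%N & tile c = a].
Proof.
suff [c cn E] : exists2 c, (c < ncol)%N & tile c = a.
  exists c; split=> //; rewrite lt0n; apply/eqP => c0.
  by have := tile_neq cn; rewrite E c0 cut0 eqxx.
apply: contrapT => no.
pose M := \big[Num.min/b]_(c < ncol) tile c.
have aM : a < M.
  apply/bigmin_gtP; split=> // i _; rewrite lt_neqAle.
  have [-> _] := tile_in (ltn_ord i); rewrite andbT.
  by apply/eqP => E; apply: no; exists i.
have Mb : M <= b by exact: bigmin_le_id.
have [c [cn _ cM]] := tiles_cover (lexx a) aM Mb.
have : M <= tile c by apply: (@bigmin_le_cond _ _ _ _ (Ordinal cn)).
by lra.
Qed.

Lemma last_tile : exists c, (c.+1 < ncol)%N /\ tile c + width c = b.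
Proof.
have [c [cn cb bc]] := tile_before ab (lexx b).
have [_ cb'] := tile_in cn.
have E : tile c + width c = b by apply/eqP; rewrite eq_le cb' bc.
exists c; split=> //; move: cn; rewrite leq_eqVlt => /predU1P[cE|//].
have := @tile_neq c; rewrite cE leqnn => /(_ isT) /eqP; case.
by move: E; rewrite /width cE cut_last; lra.
Qed.

(** The tile that covers the points just before [tile c] ends there, by
    disjointness. *)
Lemma tile_pred c : (c < ncol)%N -> tile c = a \/
  exists c', [/\ (c' < ncol)%N, tile c' < tile c & tile c = tile c' + width c'].
Proof.
move=> cn; have [ac cb] := tile_in cn; have w0 := width_gt0 cn.
move: ac; rewrite le_eqVlt => /predU1P[->|ac]; [by left|right].
have [|c' [c'n lt le]] := tile_before ac; first lra.
exists c'; split=> //; apply/eqP; rewrite eq_le le /=.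
have ne : c' != c by apply: contraTneq lt => ->; rewrite ltxx.
by case: (tile_disjoint c'n cn ne) => //; lra.
Qed.

(** Choose the velocity of each [beta_i] that is met so that its breakpoint is at
    rest.  The two assumptions on [w] then put [a] and [b] at rest as well.  So
    all widths are killed, hence all tiles by [tile_pred], hence all
    displacements between a column and its tile. *)
Lemma killed_returns (w : nat -> R) c0 c1 :
  (0 < c0)%N -> (c0 < ncol)%N -> tile c0 = a ->
  (c1.+1 < ncol)%N -> tile c1 + width c1 = b ->
  along w (cut c0) (height c0) = 0 -> along w (cut c1) (height c1) = 0 ->
  forall c, (c < ncol)%N -> along w (cut c) (height c) = 0.
Proof.
move=> c00 c0n t0 c1n t1 w0 w1.
pose v i := along w (hit_place i).1 (hit_place i).2.
have kint c : (0 < c < ncol)%N -> killed w v (cut c).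
  move=> /andP[cp cn]; have /mem_cutsP[ca|] := cut_mem cn.
    by have := @cut_lt 0%N c; rewrite cp ltnW // cut0 ca ltxx => /(_ isT).
  move=> [i [k [ir hi]]]; have [_ E _] := hi.
  apply: (killed_beta (k := k) _ ir E); first exact/JX/cutJ.
  by rewrite /v (hit_placeP hi).
have ka : killed w v a.
  rewrite -t0 tileE //; apply: killedD; first by apply: kint; rewrite c00.
  by apply: killed_along => //; apply/JX/cutJ.
have c1n' := ltnW c1n.
have kb : killed w v b.
  have -> : b = along gamma (cut c1) (height c1) + cut c1.+1.
    by rewrite -t1 tileE // /width; ring.
  by apply: killedD; [apply: killed_along => //; apply/JX/cutJ|apply: kint].
have kcut c : (c <= ncol)%N -> killed w v (cut c).
  rewrite leq_eqVlt => /predU1P[->|cn]; first by rewrite cut_last.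
  by case: c cn => [|c] cn; [rewrite cut0|apply: kint].
have ktile n : forall c : 'I_ncol, (#|[pred d : 'I_ncol | (tile d < tile c)%R]| < n)%N ->
    killed w v (tile c).
  elim: n => // n IH c; rewrite ltnS => cn.
  have [->//|[d [dn dc ->]]] := tile_pred (ltn_ord c).
  apply: killedD; last by apply: killedB; apply: kcut => //; exact: ltnW.
  apply: (IH (Ordinal dn)); apply: leq_trans cn; apply: proper_card.
  apply/properP; split; first by apply/fintype.subsetP => i; rewrite !inE => /lt_trans; apply.
  by exists (Ordinal dn); rewrite !inE ?ltxx.
move=> c cn; apply: (along_killed (v := v)); first exact/JX/cutJ.
have -> : along gamma (cut c) (height c) = tile c - cut c.
  by rewrite tileE // addrAC subrr add0r.
by apply: killedB; [exact: (ktile _ (Ordinal cn) (ltnSn _))|apply/kcut/ltnW].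
Qed.

Lemma killed_beta1 (w : nat -> R) i : (0 < i < r)%N -> killed w (fun=> 0) (beta i).
Proof.
move=> /andP[i0 ir]; exists (fun=> 0), (fun j => (j == i)%:Z); split; last first.
  by rewrite !big1 ?addr0 // => j _; rewrite ?mulr0 ?mul0r.
rewrite big1 ?add0r => [|j _]; last by rewrite mul0r.
rewrite (bigD1 (Ordinal ir)) //= eqxx mul1r big1 ?addr0 // => j /andP[_].
by rewrite -val_eqE /= => /negPf ->; rewrite mul0r.
Qed.

(** A connection would express a difference of two discontinuities, or zero, as
    a nonempty sum of translations; weighting each translation by one counts its
    length. *)
Lemma no_connection x i j k l : X x -> (0 < i < r)%N -> (0 < j < r)%N -> (k < l)%N ->
  iter k T x = beta i -> iter l T x = beta j -> False.
Proof.
move=> Xx ir jr kl xi xj; have Xi : X (beta i) by rewrite -xi; exact: XiterT.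
have : iter (l - k) T (beta i) = beta j by rewrite -xi -iterD subnK // ltnW.
rewrite iterTE // => E.
have := @along_killed (fun=> 1) (fun=> 0) (beta i) (l - k) Xi.
have -> : along gamma (beta i) (l - k) = beta j - beta i by rewrite -E; ring.
move=> /(_ (killedB (killed_beta1 _ jr) (killed_beta1 _ ir))) /eqP.
by rewrite /along sumr_const card_ord pnatr_eq0 subn_eq0 leqNgt kl.
Qed.

(** When a breakpoint [x] meets [beta_i] at time [k], the columns on both sides of
    [x] have moved together up to time [k]: by [no_connection] no other
    discontinuity was met at [x] before, so their union is unbroken. *)
Lemma hit_levels i x k : (0 < i < r)%N -> hit i x k -> exists c,
  [/\ (c.+1 < ncol)%N, (k < height c)%N /\ (k < height c.+1)%N,
      iter k T (cut c) + width c = beta i, iter k T (cut c.+1) = beta i &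
      forall w, along w (cut c) k = along w (cut c.+1) k].
Proof.
move=> ir hi; have [/andP[ax xb] xk out] := hi.
have xcut : x \in cuts by apply/mem_cutsP; right; exists i, k.
have xE : cut (index x cuts) = x by exact: nth_index.
have iN : (index x cuts < ncol)%N by rewrite index_mem.
case E : (index x cuts) xE iN => [|c] xE cn; first by rewrite -xE cut0 ltxx in ax.
have c'n := ltnW cn.
have Xx : X x by apply: JX; rewrite (ltW ax).
have ub k' : (k' <= k)%N -> unbroken (cut c) (cut c.+2) k'.
  move=> k'k; have [ac cc _ _] := column_unbroken 0%N c'n.
  have [_ cc' cb _] := column_unbroken 0%N cn.
  split=> //; first exact: lt_trans cc'.
  move=> x' j i' xc jk' ir' hi'; have jk := leq_trans jk' k'k.
  have x'cut : x' \in cuts by apply/mem_cutsP; right; exists i', j.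
  suff x'E : x' = x.
    by have [_ E' _] := hi'; rewrite x'E in E'; exact: no_connection jk E' xk.
  rewrite -xE; apply/eqP; rewrite eq_le !leNgt.
  move/andP: xc => [cx xc]; apply/andP; split; apply/negP => lt.
    by have := @cut_lt_inv c.+1 x' cn; rewrite lt xc x'cut => /(_ isT).
  by have := @cut_lt_inv c x' c'n; rewrite lt cx x'cut => /(_ isT).
have cin : cut c <= cut c.+1 < cut c.+2.
  by rewrite ltW cut_lt ?ltnSn.
have kh : (k < height c)%N.
  rewrite ltnNge; apply/negP => hk; have [h0 /andP[aR Rb] aw] := heightP c'n.
  have := flow_place (ub _ hk) aw; have [E' _ _] := flow (ub _ hk) aw cin.
  have := out (height c); rewrite h0 hk -xE /inJ E' => /(_ isT).
  move/andP: cin => [? ?].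
  by move=> H [?|[? ?]|?]; try lra; move: H; rewrite negb_and -leNgt -ltNge => /orP[]; lra.
have kh' : (k < height c.+1)%N.
  rewrite ltnNge; apply/negP => hk; have [h0 Jh _] := heightP cn.
  by have := out (height c.+1); rewrite h0 hk -xE Jh => /(_ isT).
have aw : away (cut c) k.
  have [_ _ aw] := heightP c'n; move=> j /andP[j0 jk]; apply: aw.
  by rewrite j0 (ltn_trans jk).
have [E' lE _] := flow (ub k (leqnn k)) aw cin.
exists c; split=> //.
- by rewrite -xk -xE E' /width.
- by rewrite xE.
- by move=> w; rewrite /along; apply: eq_bigr => j _; rewrite lE.
Qed.

(** * Velocities of the levels and the number of columns *)

Definition level : finType := {c : 'I_ncol & 'I_(height c)}.
Definition column (A : level) : nat := tag A.
Definition time (A : level) : nat := tagged A.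
Definition place A := iter (time A) T (cut (column A)).
Definition breadth A := width (column A).
Definition tag_letter A := letter (place A).
Definition drift w A := along w (cut (column A)) (time A).

Definition mk_level c k (cn : (c < ncol)%N) (kh : (k < height c)%N) : level :=
  Tagged (fun c : 'I_ncol => 'I_(height c)) (Ordinal kh : 'I_(height (Ordinal cn))).

Lemma column_lt A : (column A < ncol)%N. Proof. exact: ltn_ord. Qed.
Lemma time_lt A : (time A < height (column A))%N. Proof. exact: ltn_ord. Qed.

Lemma level_ext A B : column A = column B -> time A = time B -> A = B.
Proof.
case: A B => [c k] [c' k']; rewrite /column /time /= => /val_inj E.
by case: _ / E k' => k' /val_inj ->.
Qed.

Lemma place_disjoint A B : A != B ->
  place A + breadth A <= place B \/ place B + breadth B <= place A.
Proof.
move=> ne; apply: level_disjoint; rewrite ?column_lt ?time_lt //.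
by apply: contra_neq ne => -[]; exact: level_ext.
Qed.

Lemma place_X A : X (place A).
Proof. by apply/XiterT/JX/cutJ/column_lt. Qed.

Lemma breadth_gt0 A : 0 < breadth A.
Proof. exact/width_gt0/column_lt. Qed.

Lemma away_le c k : (c < ncol)%N -> (k <= height c)%N -> away (cut c) k.
Proof.
move=> cn kh; have [_ _ aw] := heightP cn => j /andP[j0 jk].
by apply: aw; rewrite j0 (leq_trans jk).
Qed.

Lemma place_letter_ge A : beta (tag_letter A) <= place A.
Proof. by have [_ /andP[]] := letterP (X01 (place_X A)). Qed.

Lemma tag_letter_lt A : (tag_letter A < r)%N.
Proof. by have [] := letterP (X01 (place_X A)). Qed.

Lemma tag_letter_mono A B : place A + breadth A <= place B ->
  (tag_letter A <= tag_letter B)%N.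
Proof.
move=> AB; have /andP[A0 A1] := X01 (place_X A); have /andP[B0 B1] := X01 (place_X B).
by apply: letter_mono => //; have := breadth_gt0 A; lra.
Qed.

Lemma drift_step w : (forall c, (c < ncol)%N -> along w (cut c) (height c) = 0) ->
  forall A, level_step place breadth tag_letter gamma a b (drift w) w A.
Proof.
move=> w0 A; have cn := column_lt A.
have TP : place A + gamma (tag_letter A) = iter (time A).+1 T (cut (column A)).
  by rewrite iterS -/(place A) (TXE (place_X A)).
have HA : drift w A + w (tag_letter A) = along w (cut (column A)) (time A).+1.
  by rewrite alongS.
have := time_lt A; rewrite leq_eqVlt => /predU1P[E|lt]; [right|left].
  rewrite addrAC TP HA E; have [? ?] := tile_in cn; split=> //; exact: w0.
exists (mk_level cn lt); split=> //; rewrite /outside /=.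
have aw := away_le cn (ltnW lt).
have out : ~~ inJ (iter (time A).+1 T (cut (column A))).
  by apply: (away_le cn lt); rewrite ltnSn.
case: (flow_place (column_unbroken _ cn) aw) => [h|[h1 h2]|h]; [by left| |by right].
have := width_gt0 cn; move: out; rewrite /inJ /width negb_and -leNgt -ltNge.
by case/orP=> *; lra.
Qed.

Lemma hit_level i x k : (0 < i < r)%N -> hit i x k -> exists A B,
  [/\ tag_letter B = i, (tag_letter A < i)%N, place A + breadth A = beta i,
     place B = beta i & forall w, drift w A = drift w B].
Proof.
move=> ir hi; have [c [cn [kh kh'] cE cE' dE]] := hit_levels ir hi.
exists (mk_level (ltnW cn) kh), (mk_level cn kh').
have /andP[i0 ir'] := ir.
split=> //.
  rewrite /tag_letter /place /= cE'; apply: letter_eq => //.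
  by rewrite lexx beta_lt.
rewrite ltnNge; apply/negP => h; have w0 := width_gt0 (ltnW cn).
have := place_letter_ge (mk_level (ltnW cn) kh); rewrite [X in _ <= X]/place /=.
have := @beta_le i (tag_letter (mk_level (ltnW cn) kh)).
by rewrite h ltnW ?tag_letter_lt// => /(_ isT); lra.
Qed.

(** The last level on the left of [beta_i] and the first one on its right, if the
    latter has letter [i]. *)
Definition neighbours i (p : level * level) :=
  [/\ adjacent place breadth p.1 p.2, (tag_letter p.1 < i)%N & tag_letter p.2 = i].

Lemma neighbours_uniq i p q : neighbours i p -> neighbours i q -> p = q.
Proof.
case: p q => [A B] [A' B'] [[/= AB nAB] Ai Bi] [[/= AB' nAB'] Ai' Bi'].
have before C D : (tag_letter C < i)%N -> tag_letter D = i -> place C + breadth C <= place D.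
  move=> Ci Di; have [E|/place_disjoint[//|]] := eqVneq C D; first by rewrite -Di E ltnn in Ci.
  by move/tag_letter_mono; rewrite Di leqNgt Ci.
have BB : B = B'.
  apply/eqP; apply: contraT => /place_disjoint[h|h].
    by case: (nAB' B); split=> //; exact: before.
  by case: (nAB B'); split=> //; exact: before.
subst B'; congr (_, _); apply/eqP; apply: contraT => /place_disjoint[h|h].
  by case: (nAB A').
by case: (nAB' A).
Qed.

Lemma hit_adjacent i x k : (0 < i < r)%N -> hit i x k ->
  forall A B, neighbours i (A, B) -> forall w, drift w A = drift w B.
Proof.
move=> ir hi A B nAB; have [A' [B' [iB' iA' eA' lB' dE]]] := hit_level ir hi.
suff [-> ->] : (A, B) = (A', B') by [].
apply: neighbours_uniq nAB _; split=> //; split=> /=; first by rewrite eA' lB'.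
by move=> C [h1 h2]; have := breadth_gt0 C; lra.
Qed.

(** The linear equation attached to the threshold [beta_i]: the levels facing each
    other there have the same drift.  When there is no such pair, the equation is
    spent on a letter that no level has: on [i] if it is such a letter, and
    otherwise on [0], which is one because [i] is then the least letter of a
    level. *)
Definition condition (i : nat) : nat -> R :=
  if [pick p | `[< neighbours i p >]] is Some (A, B) then
    fun j => (visits (cut (column A)) (time A) j)%:R -
             (visits (cut (column B)) (time B) j)%:R
  else if [exists A, tag_letter A == i] then fun j => (j == 0%N)%:R
  else fun j => (j == i)%:R.

Lemma sum_delta (w : nat -> R) i : (i < r)%N ->
  \sum_(j < r) w j * ((j : nat) == i)%:R = w i.
Proof.
move=> ir; rewrite (bigD1 (Ordinal ir)) //= eqxx mulr1 big1 ?addr0 // => j.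
by rewrite -val_eqE /= => /negPf ->; rewrite mulr0.
Qed.

Lemma drift_visits w A :
  drift w A = \sum_(j < r) w j * (visits (cut (column A)) (time A) j)%:R.
Proof.
rewrite /drift along_visits; last exact/JX/cutJ/column_lt.
by apply: eq_bigr => j _; rewrite mulrC.
Qed.

(** With at least three columns there are at least two met thresholds; these need
    no equation, so two equations for the returns and one for each remaining
    threshold are fewer than [r]. *)
Lemma ncol_le2 : (ncol <= 2)%N.
Proof.
rewrite leqNgt; apply/negP => n3.
have [c0 [c00 c0n t0]] := first_tile; have [c1 [c1n t1]] := last_tile.
pose C := (bool + {i : 'I_r | (0 < i)%N && ~~ hitp i})%type.
pose q (c : C) : nat -> R := match c with
  | inl true => fun j => (visits (cut c0) (height c0) j)%:R
  | inl false => fun j => (visits (cut c1) (height c1) j)%:R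
  | inr i => condition (val (val i)) end.
have r0 : (0 < r)%N.
  by have := ncol_gt0; have [] := letterP (X01 (JX (cutJ c0n))); case: r.
have Cr : (#|{: C}| < r)%N.
  rewrite card_sum card_bool card_sig.
  pose N := #|[pred i : 'I_r | (0 < i)%N && ~~ hitp i]|.
  have NC : (N < #|[predC hitp]|)%N.
    apply: proper_card; apply/properP; split.
      by apply/fintype.subsetP => i; rewrite !inE => /andP[].
    by exists (Ordinal r0); rewrite !inE.
  have {NC} : (#|hitp| + N < r)%N.
    by rewrite -[X in (_ < X)%N](card_ord r) -(cardC hitp) ltn_add2l.
  suff : (#|hitp| + N < r)%N -> (2 + N < r)%N by [].
  have := ncol_le; move: #|hitp| => M; move: n3; lia.
have [w [[i ir wi] wq]] := exists_orthogonal q Cr.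
have alongE c k : X (cut c) -> along w (cut c) k =
    \sum_(j < r) w j * (visits (cut c) k j)%:R.
  by move=> Xc; rewrite along_visits//; apply: eq_bigr => j _; rewrite mulrC.
have ret : forall c, (c < ncol)%N -> along w (cut c) (height c) = 0.
  have c1n' := ltnW c1n.
  apply: (killed_returns c00 c0n t0 c1n t1).
    by rewrite (alongE _ _ (JX (cutJ c0n))); exact: (wq (inl true)).
  by rewrite (alongE _ _ (JX (cutJ c1n'))); exact: (wq (inl false)).
have cond j : (0 < j < r)%N -> (forall x k, ~ hit j x k) ->
    \sum_(i < r) w i * condition j i = 0.
  move=> /andP[j0 jr] nh.
  have jP : (0 < Ordinal jr)%N && ~~ hitp (Ordinal jr).
    by rewrite j0 negb_and j0 /=; apply/asboolPn => -[x [k]]; exact: nh.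
  exact: (wq (inr (exist _ (Ordinal jr) jP))).
have h0 : (0 < height 0%N)%N by have [] := heightP ncol_gt0.
have nl : (ncol.-1 < ncol)%N by rewrite prednK ?ncol_gt0.
have hl : (0 < height ncol.-1)%N by have [] := heightP nl.
have rigid := @levels_rigid R level place breadth tag_letter gamma a b
  (mk_level ncol_gt0 h0) (mk_level nl hl) breadth_gt0 place_disjoint tag_letter_mono.
have {rigid} H0 : forall A, drift w A = 0.
  apply: (rigid _ _ _ _ w).
  - by rewrite /place /= cut0.
  - rewrite /place /breadth /width /= prednK ?ncol_gt0 // cut_last; ring.
  - by move=> n f n0; apply: (@acyclic n (fun j => tag_letter (f j))) => // j; exact: tag_letter_lt.
  - by rewrite /drift /along big_ord0.
  - by rewrite /drift /along big_ord0.
  - exact: drift_step.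
  - move=> A B sAB aAB; have nAB : neighbours (tag_letter B) (A, B) by split.
    have jr : (0 < tag_letter B < r)%N by rewrite tag_letter_lt (leq_ltn_trans _ sAB).
    have [[x [k hi]]|nh] := pselect (exists x k, hit (tag_letter B) x k).
      exact: hit_adjacent jr hi _ _ nAB w.
    have := cond _ jr (fun x k h => nh (ex_intro _ x (ex_intro _ k h))).
    rewrite /condition; case: pickP => [[A' B'] /asboolP|/(_ (A, B))/asboolP//].
    move=> /neighbours_uniq/(_ nAB)[-> ->]; rewrite !drift_visits => E.
    apply/eqP; rewrite -subr_eq0 -[X in _ == X]E -sumrB; apply/eqP.
    by apply: eq_bigr => j _; rewrite mulrBr.
have used A : w (tag_letter A) = 0.
  by have [[A' [_ _ _]]|[_ _]] := drift_step ret A; rewrite !H0 add0r.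
have unused j : (0 < j < r)%N -> (forall A, tag_letter A != j) -> w j = 0.
  move=> jr nu; have /andP[j0 jr'] := jr.
  have := cond j jr; rewrite /condition; case: pickP => [[A B] /asboolP[_ _ /= E]|_].
    by have := nu B; rewrite E eqxx.
  case: existsP => [[A /eqP E]|_]; first by have := nu A; rewrite E eqxx.
  rewrite sum_delta //; apply=> x k hi.
  by have [A' [B' [E _ _ _ _]]] := hit_level jr hi; have := nu B'; rewrite E eqxx.
suff w0 : w 0%N = 0.
  move/eqP: wi; apply; case: (posnP i) => [->//|i0].
  have [A E|nu] := pickP (fun A => tag_letter A == i); first by rewrite -(eqP E) used.
  by apply: unused; [rewrite i0|move=> A; rewrite nu].
have [A /eqP <-|nu] := pickP (fun A => tag_letter A == 0%N); first exact: used.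
have ex : exists j, [exists A, tag_letter A == j].
  by exists (tag_letter (mk_level ncol_gt0 h0)); apply/existsP; eexists; exact: eqxx.
case: (ex_minnP ex) => j /existsP[A /eqP Aj] jmin.
have least B : (j <= tag_letter B)%N by apply: jmin; apply/existsP; exists B.
have jr : (0 < j < r)%N by rewrite -Aj tag_letter_lt lt0n nu.
have := cond j jr; rewrite /condition; case: pickP => [[B B'] /asboolP[_ /=]|_].
  by rewrite ltnNge least.
case: existsP => [_|[]]; last by exists A; rewrite Aj.
rewrite sum_delta //; apply=> x k hi.
by have [B [_ [_ + _ _ _]]] := hit_level jr hi; rewrite ltnNge least.
Qed.

(** * The first return map is an irrational rotation *)

Lemma two_columns : exists y h h', [/\ a < y < b,
  [/\ (0 < h)%N, unbroken a y h, away a h & along gamma a h = b - y] &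
  [/\ (0 < h')%N, unbroken y b h', away y h' & along gamma y h' = a - y]].
Proof.
have [c0 [c00 c0n t0]] := first_tile; have [c1 [c1n t1]] := last_tile.
have n2 : ncol = 2%N by apply/eqP; rewrite eqn_leq ncol_le2 (leq_ltn_trans _ c1n).
have {c00 c0n} E0 : c0 = 1%N by move: c0n c00; rewrite n2; case: c0 {t0} => [|[]].
have {c1n} E1 : c1 = 0%N by move: c1n; rewrite n2; case: c1 {t1}.
subst c0 c1; have cut2 : cut 2%N = b by rewrite -n2 cut_last.
have n0 : (0 < ncol)%N by rewrite n2.
have n1 : (1 < ncol)%N by rewrite n2.
have [h0 _ aw0] := heightP n0; have [h1 _ aw1] := heightP n1.
have := column_unbroken (height 0%N) n0; have := column_unbroken (height 1%N) n1.
have := tileE n0; have := tileE n1; rewrite t0 cut0 cut2 => E1 E0 ub1 ub0.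
rewrite cut0 in aw0 E0; exists (cut 1%N), (height 0%N), (height 1%N); split.
- by have [_ ? _ _] := ub0; have [_ ? _ _] := ub1; apply/andP.
- split=> //; move: t1; rewrite /width cut0 E0; lra.
- split=> //; rewrite E1; ring.
Qed.

Lemma component_rotation : exists alpha : R, irrational alpha /\
  forall x, a <= x < b -> first_return T `[a, b[%classic x
    (a + (b - a) * rotation alpha ((x - a) / (b - a))).
Proof.
have [y [h [h' [/andP[ay yb] [h0 ub aw g] [h0' ub' aw' g']]]]] := two_columns.
have ba0 : b - a != 0 by rewrite subr_eq0 gt_eqF.
have ba : 0 < b - a by rewrite subr_gt0.
pose alpha := (b - y) / (b - a); exists alpha; split.
  move=> /rationalP[p [q E]].
  have Xa : X a by apply: JX; rewrite lexx.
  have Xy : X y by apply: JX; rewrite ltW.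
  have q0 : (0 < q)%N.
    rewrite lt0n; apply/eqP => q0; move: E; rewrite q0 invr0 mulr0 /alpha => /eqP.
    by rewrite mulf_eq0 invr_eq0 (negPf ba0) orbF subr_eq0 gt_eqF.
  have qR : (0 : R) < q%:R by rewrite ltr0n.
  have pq : p%:~R * (b - a) = q%:R * (b - y).
    have -> : p%:~R = alpha * q%:R by rewrite E divfK // gt_eqF.
    by rewrite /alpha mulrAC divfK // mulrC.
  have p0 : 0 < p.
    by rewrite -(ltr0z R) -(pmulr_lgt0 _ ba) pq mulr_gt0 // subr_gt0.
  have pltq : p < q%:Z.
    by rewrite -(ltr_int R) -(ltr_pM2r ba) pq ltr_pM2l // ltrD2l ltrN2.
  have := @indep (fun i => (q%:Z - p) * (visits a h i)%:Z + p * (visits y h' i)%:Z)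
    (fun=> 0); case.
    rewrite [X in _ + X]big1 ?addr0; last by move=> i _; rewrite mul0r.
    transitivity ((q%:R - p%:~R) * along gamma a h + p%:~R * along gamma y h').
      rewrite !along_visits // !mulr_sumr -big_split /=; apply: eq_bigr => i _.
      by rewrite rmorphD !rmorphM rmorphB /= mulrDl !mulrA.
    by rewrite g g'; lra.
  move=> n0 _.
  have : \sum_(i < r) ((q%:Z - p) * (visits a h i)%:Z + p * (visits y h' i)%:Z) = 0.
    by apply: big1 => i _; exact: n0.
  rewrite big_split /= -!mulr_sumr -!(rmorph_sum Posz) /= !visits_total //.
  by nia.
move=> x /andP[ax xb].
have J z : (`[a, b[%classic : set R) z <-> inJ z by rewrite /= in_itv.
have floorE (z : R) (n : int) : n%:~R <= z < n%:~R + 1 -> Num.floor z = n.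
  by move=> zn; apply: floor_def; rewrite intrD.
have divs z : (b - a) * (z / (b - a)) = z by rewrite mulrCA mulfV // mulr1.
have [xy|yx] := ltP x y.
  exists h; have xu : a <= x < y by rewrite ax xy.
  have [E _ awx] := flow ub aw xu.
  have {}E : iter h T x = x + (b - y).
    by rewrite E iterTE ?g; [ring|apply: JX; rewrite lexx].
  have RE : a + (b - a) * rotation alpha ((x - a) / (b - a)) = x + (b - y).
    rewrite /rotation -mulrDl (floorE _ 0); last first.
      by rewrite add0r divr_ge0 ?ltr_pdivrMr //; lra.
    by rewrite subr0 divs; ring.
  split=> //; rewrite ?RE //; first by apply/J; rewrite /inJ; apply/andP; lra.
  by move=> m mh /J; apply/negP; exact: awx.
exists h'; have xu : y <= x < b by rewrite yx xb.
have [E _ awx] := flow ub' aw' xu.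
have {}E : iter h' T x = x + (a - y).
  by rewrite E iterTE ?g'; [ring|apply: JX; rewrite ltW].
have RE : a + (b - a) * rotation alpha ((x - a) / (b - a)) = x + (a - y).
  rewrite /rotation -mulrDl (floorE _ 1); last first.
    by rewrite ler_pdivlMr // ltr_pdivrMr //; lra.
  by rewrite mulrBr divs mulr1; ring.
split=> //; rewrite ?RE //; first by apply/J; rewrite /inJ; apply/andP; lra.
by move=> m mh /J; apply/negP; exact: awx.
Qed.

End Component.
End Dynamics.

(** * The attractor and its components *)

Section Tame.
Variable R : realType.
Implicit Types (A B : set R) (y c : R).

Local Notation mu := (@lebesgue_measure R).

Lemma measurable_shift A c : measurable A -> measurable ((fun y => y - c) @^-1` A).
Proof.
move=> mA; rewrite -[X in measurable X]setTI.
by apply: (measurable_realfun.measurable_funB (@measurable_id _ _ _) (@measurable_cst _ _ _ _ _ c)).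
Qed.

Lemma lebesgue_shift A c : measurable A -> mu ((fun y => y - c) @^-1` A) = mu A.
Proof.
move=> mA; have mf : measurable_fun [set: measurableTypeR R]
    ((fun y => y - c) : measurableTypeR R -> measurableTypeR R).
  exact: (measurable_realfun.measurable_funB (@measurable_id _ _ _) (@measurable_cst _ _ _ _ _ c)).
pose nu := measure_function_pushforward__canonical__measure_function_Measure mu mf.
have -> // : mu A = nu A.
apply: lebesgue_measure_unique => // X /ocitvP[->|[[u v] /= uv ->]].
  by rewrite !measure0.
rewrite /nu /= /pushforward.
rewrite [X in _ = mu X](_ : _ = `]u + c, v + c]%classic); last first.
  by apply/seteqP; split => z /=; rewrite !in_itv /= => /andP[? ?]; apply/andP; lra.
by rewrite !lebesgue_measure_itv /= !lte_fin ltrD2r -!EFinB; case: ifP => // _; congr EFin; ring.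
Qed.

(** Local description of the finite unions of intervals [[c, d)] among bounded
    sets: constant membership on a right neighbourhood, point included, and on a
    punctured left neighbourhood.  Unlike lists of intervals, it passes to
    unions, intersections and translates without bookkeeping. *)
Definition right_germ A y := exists2 e, 0 < e & forall x, y <= x < y + e -> (A x <-> A y).
Definition left_germ A y := exists2 e, 0 < e & forall x z,
  y - e <= x < y -> y - e <= z < y -> (A x <-> A z).
Definition tame A := [/\ measurable A, forall y, right_germ A y & forall y, left_germ A y].

Lemma tame_op (op : Prop -> Prop -> Prop) A B : tame A -> tame B ->
  (forall P P' Q Q' : Prop, (P <-> P') -> (Q <-> Q') -> (op P Q <-> op P' Q')) ->
  measurable [set x | op (A x) (B x)] -> tame [set x | op (A x) (B x)].
Proof.
move=> [mA rA lA] [mB rB lB] opE m; split=> // y.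
  have [e e0 hA] := rA y; have [d d0 hB] := rB y.
  exists (Num.min e d); first by rewrite lt_min e0.
  move=> x /andP[yx]; rewrite -ltrBlDl lt_min => /andP[xe xd] /=.
  by apply: opE; [apply: hA|apply: hB]; apply/andP; lra.
have [e e0 hA] := lA y; have [d d0 hB] := lB y.
exists (Num.min e d); first by rewrite lt_min e0.
move=> x z /andP[xm xy] /andP[zm zy] /=.
have [me md] : Num.min e d <= e /\ Num.min e d <= d by rewrite !ge_min !lexx orbT.
by apply: opE; [apply: hA|apply: hB]; apply/andP; lra.
Qed.

Lemma tameU A B : tame A -> tame B -> tame (A `|` B).
Proof.
move=> tA tB; apply: (tame_op (op := or)) => //; first by tauto.
by case: tA tB => [? _ _] [? _ _]; exact: measurableU.
Qed.

Lemma tameI A B : tame A -> tame B -> tame (A `&` B).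
Proof.
move=> tA tB; apply: (tame_op (op := and)) => //; first by tauto.
by case: tA tB => [? _ _] [? _ _]; exact: measurableI.
Qed.

Lemma tame0 : tame set0.
Proof. by split=> // y; exists 1. Qed.

Lemma tame_itv c d : tame `[c, d[%classic.
Proof.
split=> // y.
  have [cy|yc] := leP c y; have [dy|yd] := leP d y.
  - by exists 1 => // x /andP[? ?] /=; rewrite !in_itv /=; split=> /andP[? ?]; apply/andP; lra.
  - exists (d - y); first by rewrite subr_gt0.
    by move=> x /andP[? ?] /=; rewrite !in_itv /=; split=> /andP[? ?]; apply/andP; lra.
  - by exists 1 => // x /andP[? ?] /=; rewrite !in_itv /=; split=> /andP[? ?]; apply/andP; lra.
  - exists (c - y); first by rewrite subr_gt0.
    by move=> x /andP[? ?] /=; rewrite !in_itv /=; split=> /andP[? ?]; apply/andP; lra.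
have [cy|yc] := leP y c; have [dy|yd] := leP y d.
- exists 1 => // x z /andP[? ?] /andP[? ?] /=; rewrite !in_itv /=; split=> /andP[? ?]; apply/andP; lra.
- exists 1 => // x z /andP[? ?] /andP[? ?] /=; rewrite !in_itv /=; split=> /andP[? ?]; apply/andP; lra.
- exists (y - c); first by rewrite subr_gt0.
  move=> x z /andP[? ?] /andP[? ?] /=; rewrite !in_itv /=; split=> /andP[? ?]; apply/andP; lra.
- exists (y - d); first by rewrite subr_gt0.
  move=> x z /andP[? ?] /andP[? ?] /=; rewrite !in_itv /=; split=> /andP[? ?]; apply/andP; lra.
Qed.

Lemma tame_shift A c : tame A -> tame ((fun y => y - c) @^-1` A).
Proof.
move=> [mA rA lA]; split=> [|y|y]; first exact: measurable_shift.
  have [e e0 h] := rA (y - c); exists e => // x /andP[? ?] /=.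
  by apply: h; apply/andP; lra.
have [e e0 h] := lA (y - c); exists e => // x z /andP[? ?] /andP[? ?] /=.
by apply: h; apply/andP; lra.
Qed.

Definition maximal_in A u v := forall p q, p < q -> (forall x, p <= x < q -> A x) ->
  [\/ q <= u, u <= p /\ q <= v | v <= p].

(** The ends are found as a supremum and an infimum.  The left germ at the
    infimum misses [A], as it could otherwise be added; and the supremum is not in
    [A] by its right germ. *)
Lemma tame_component A x : tame A -> (forall z, A z -> 0 <= z < 1) -> A x ->
  exists u v, [/\ u < v, forall z, u <= z < v -> A z, maximal_in A u v &
    connected_component A x = `[u, v[%classic].
Proof.
move=> [_ rA lA] A01 Ax.
pose E := [set v | x <= v /\ forall z, x <= z < v -> A z].
have Ex : E x by split=> // z; lra.
have E1 : ubound E 1.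
  move=> v [xv hv]; rewrite leNgt; apply/negP => v1.
  have := hv 1; have /andP[? ?] := A01 _ Ax; rewrite v1 ltW // => /(_ isT) /A01; lra.
have supE : has_sup E by split; [exists x|exists 1].
pose v := sup E.
have xv : x <= v by apply: sup_upper_bound.
have Av z : x <= z < v -> A z.
  move=> /andP[xz zv]; have [w [xw hw] zw] := sup_adherent (eps := v - z) ltac:(lra) supE.
  by apply: hw; rewrite xz /=; move: zw; rewrite -/v; lra.
have nAv : ~ A v.
  move=> Avv; have [e e0 h] := rA v.
  have : E (v + e).
    split; first lra.
    move=> z /andP[xz zv]; have [zv'|vz] := ltP z v; first by apply: Av; rewrite xz.
    by apply/h; rewrite ?vz.
  by move=> /(sup_upper_bound supE); rewrite -/v; lra.
have {}xv : x < v by rewrite lt_neqAle xv andbT; apply/eqP => E'; apply: nAv; rewrite -E'.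
pose F := [set u | u <= x /\ forall z, u <= z <= x -> A z].
have Fx : F x by split=> // z /andP[? ?]; have -> : z = x by apply/eqP; rewrite eq_le; apply/andP.
have F0 : lbound F 0.
  by move=> u [ux hu]; have /A01/andP[] : A u by apply: hu; rewrite lexx.
have infF : has_inf F by split; [exists x|exists 0].
pose u := inf F.
have ux : u <= x by apply: ge_inf => //; case: infF.
have Au' z : u < z <= x -> A z.
  move=> /andP[uz zx]; have [w [wx hw] zw] := inf_adherent (eps := z - u) ltac:(lra) infF.
  by apply: hw; rewrite zx andbT; move: zw; rewrite -/u; lra.
have Auu : A u.
  move: ux; rewrite le_eqVlt => /predU1P[->//|ux].
  have [e e0 h] := rA u; pose z := u + Num.min (x - u) e / 2.
  have m0 : 0 < Num.min (x - u) e by rewrite lt_min e0 subr_gt0 ux.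
  have [m1 m2] : Num.min (x - u) e <= x - u /\ Num.min (x - u) e <= e.
    by rewrite !ge_min !lexx orbT.
  by apply/(h z); [apply/andP; rewrite /z; lra|apply: Au'; apply/andP; rewrite /z; lra].
have [e e0 h] := lA u.
have nAu z : u - e <= z < u -> ~ A z.
  move=> zu Az; have : F (u - e).
    split; first lra.
    move=> t /andP[et tx]; have [tu|] := ltP t u; first by apply/(h t z); rewrite ?et.
    by rewrite le_eqVlt => /predU1P[<-//|ut]; apply: Au'; rewrite ut.
  by move=> /(ge_inf (proj2 infF)); rewrite -/u; lra.
have Auv z : u <= z < v -> A z.
  move=> /andP[uz zv]; have [xz|zx] := leP x z; first by apply: Av; rewrite xz.
  by move: uz; rewrite le_eqVlt => /predU1P[<-//|uz]; apply: Au'; rewrite uz ltW.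
exists u, v; split=> //; first lra.
- move=> p q pq hpq; have [qu|uq] := leP q u; first by constructor 1.
  have [vp|pv] := leP v p; first by constructor 3.
  constructor 2; split.
    rewrite leNgt; apply/negP => pu; pose z := Num.max p (u - e).
    have zu : u - e <= z < u by rewrite /z le_max lexx orbT gt_max pu /=; lra.
    by apply: (nAu z zu); apply: hpq; rewrite /z le_max lexx /=; move: zu => /andP[_]; rewrite -/z; lra.
  by rewrite leNgt; apply/negP => vq; apply/nAv/hpq; rewrite ltW.
- apply/seteqP; split => [z [C [Cx CA Ci] Cz]|].
    move/connected_intervalP : Ci => Ci; rewrite /= in_itv /=; apply/andP; split.
      rewrite leNgt; apply/negP => zu; pose t := Num.max z (u - e).
      have tu : u - e <= t < u by rewrite /t le_max lexx orbT gt_max zu /=; lra.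
      apply: (nAu t tu); apply/CA/(Ci z x) => //; move/andP: tu => [_ tu].
      by rewrite /t le_max lexx /= -/t; lra.
    rewrite ltNge; apply/negP => vz; apply/nAv/CA/(Ci x z) => //.
    by rewrite vz ltW.
  apply: connected_component_max.
  - by rewrite /= in_itv /= ux.
  - by move=> z; rewrite /= in_itv /=; exact: Auv.
  - apply/connected_intervalP => p q; rewrite /= !in_itv /= => /andP[? ?] /andP[? ?] z /andP[? ?].
    by rewrite in_itv /=; apply/andP; lra.
Qed.

End Tame.

Section FiniteType.
Variables (R : realType) (r : nat) (beta gamma : nat -> R) (T : R -> R).
Hypothesis beta0 : beta 0%N = 0.
Hypothesis betar : beta r = 1.
Hypothesis beta_lt : forall i, (i < r)%N -> beta i < beta i.+1.
Hypothesis TE : forall i x, (i < r)%N -> beta i <= x < beta i.+1 -> T x = x + gamma i.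
Hypothesis T01 : forall x, 0 <= x < 1 -> 0 <= T x < 1.

Local Notation mu := (@lebesgue_measure R).
Local Notation piece i := (`[beta i, beta i.+1[%classic : set R).

Lemma imageE (A : set R) : (forall x, A x -> 0 <= x < 1) ->
  T @` A = \big[setU/set0]_(i < r) ((fun y => y - gamma i) @^-1` (A `&` piece i)).
Proof.
move=> A01; rewrite -(bigcup_mkord r (fun i => (fun y => y - gamma i) @^-1` (A `&` piece i))).
apply/seteqP; split=> [_ [x Ax <-]|y [i /= ir [Ay]]].
  have [lr lx] := letterP beta0 betar (A01 _ Ax).
  exists (letter r beta x) => //=; rewrite (TE lr lx) addrK; split=> //.
by rewrite in_itv /= => iy; exists (y - gamma i) => //; rewrite (TE ir iy) subrK.
Qed.

Lemma tame_big (F : nat -> set R) n : (forall i, tame (F i)) ->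
  tame (\big[setU/set0]_(i < n) F i).
Proof. by move=> tF; elim/big_ind: _ => //; [exact: tame0|exact: tameU]. Qed.

Lemma tame_image A : (forall x, A x -> 0 <= x < 1) -> tame A -> tame (T @` A).
Proof.
move=> A01 tA; rewrite imageE //.
apply: (tame_big _ (F := fun i => (fun y => y - gamma i) @^-1` (A `&` piece i))).
by move=> i; apply/tame_shift/tameI => //; exact: tame_itv.
Qed.

Lemma measure_image (A : set R) : measurable A -> (forall x, A x -> 0 <= x < 1) ->
  (mu (T @` A) <= mu A)%E.
Proof.
move=> mA A01; rewrite imageE //.
have mAi i : measurable (A `&` piece i) by apply: measurableI.
apply: le_trans.
  apply: (Boole_inequality mu (A := fun i => (fun y => y - gamma i) @^-1` (A `&` piece i))).
  by move=> i _; exact: measurable_shift.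
rewrite (eq_bigr (fun i : 'I_r => mu (A `&` piece i))); last first.
  by move=> i _; exact: lebesgue_shift.
rewrite -measure_bigsetU_ord //; last first.
  apply/trivIsetP => i j _ _ ij; apply/seteqP; split=> // x [[Ax xi] [_ xj]].
  move: xi xj; rewrite /= !in_itv /= => xi xj; move/eqP: ij; apply; apply: val_inj.
  by rewrite /= -(letter_eq beta0 betar beta_lt (ltn_ord i) xi)
    (letter_eq beta0 betar beta_lt (ltn_ord j) xj).
  by move=> i; exact: mAi.
apply: (@le_measure _ _ _ mu); rewrite ?inE //; first by apply: bigsetU_measurable => i _; exact: mAi.
by elim/big_ind: _ => [|B C BA CA|i _]; [exact: sub0set|rewrite subUset|exact: subIsetl].
Qed.

Lemma measure_lt_oo (A : set R) : measurable A -> (forall x, A x -> 0 <= x < 1) ->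
  mu A \is a fin_num.
Proof.
move=> mA A01; rewrite ge0_fin_numE //.
apply: (@le_lt_trans _ _ (mu `[0, 1[%classic)).
  by apply: le_measure; rewrite ?inE // => x /A01; rewrite /= in_itv.
by rewrite lebesgue_measure_itv /= lte_fin ltr01 -EFinB ltry.
Qed.

(** If two points had the same image, then so would two intervals to the right of
    them, and one of these could be removed from [X] without changing the image:
    a set of smaller measure would be mapped onto [X]. *)
Lemma tame_injective (X : set R) : tame X -> (forall x, X x -> 0 <= x < 1) ->
  T @` X = X -> forall x y, X x -> X y -> T x = T y -> x = y.
Proof.
move=> [mX rX _] X01 TX x y Xx Xy Txy.
have [lx /andP[xl xl']] := letterP beta0 betar (X01 _ Xx).
have [ly /andP[yl yl']] := letterP beta0 betar (X01 _ Xy).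
set i := letter r beta x in lx xl xl'; set j := letter r beta y in ly yl yl'.
have Tx : T x = x + gamma i by apply: TE => //; rewrite xl.
have Ty : T y = y + gamma j by apply: TE => //; rewrite yl.
have [ij|ij] := eqVneq i j; first by move: Txy; rewrite Tx Ty ij => /addIr.
have [d d0 hx] := rX x; have [d' d'0 hy] := rX y.
pose e := Num.min (Num.min d d') (Num.min (beta i.+1 - x) (beta j.+1 - y)).
have e0 : 0 < e by rewrite !lt_min d0 d'0 !subr_gt0 xl'.
have [ed ed' ei ej] : [/\ e <= d, e <= d', e <= beta i.+1 - x & e <= beta j.+1 - y].
  by split; rewrite !ge_min lexx ?orbT.
pose A := X `\` `[x, x + e[%classic.
have mA : measurable A by exact: measurableD.
have XA : X `<=` T @` A.
  move=> w Xw; have [z Xz <-] : (T @` X) w by rewrite TX.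
  have [zx|zx] := pselect (x <= z < x + e); last first.
    by exists z => //; split=> //; rewrite /= in_itv /=.
  have zj : beta j <= z - x + y < beta j.+1.
    by move/andP: zx => [? ?]; apply/andP; lra.
  exists (z - x + y); last first.
    rewrite (TE ly zj) (@TE i) //; last by move/andP: zx => [? ?]; apply/andP; lra.
    by move: Txy; rewrite Tx Ty; lra.
  split; first by apply/hy => //; move/andP: zx => [? ?]; apply/andP; lra.
  rewrite /= in_itv /= => zi; move/eqP: ij; apply.
  have zi' : beta i <= z - x + y < beta i.+1.
    by move/andP: zi => [? ?]; apply/andP; lra.
  rewrite -(letter_eq beta0 betar beta_lt lx zi').
  exact: letter_eq zj.
have A01 z : A z -> 0 <= z < 1 by move=> [/X01].
have muXA : (mu X <= mu A)%E.
  apply: le_trans (measure_image mA A01); apply: le_measure => //; rewrite inE //.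
  by rewrite imageE //; apply: bigsetU_measurable => k _; apply: measurable_shift; exact: measurableI.
have XE : X = A `|` `[x, x + e[%classic.
  apply/seteqP; split=> [z Xz|z [[]//|]].
    by have [zx|zx] := pselect (`[x, x + e[%classic z); [right|left].
  rewrite /= in_itv /= => zx; apply/hx => //; move/andP: zx => [? ?]; apply/andP; lra.
have : (mu X = mu A + e%:E)%E.
  transitivity (mu A + mu `[x, (x + e)%R[%classic)%E; last first.
    by rewrite lebesgue_measure_itv /= lte_fin ltrDl e0 -EFinB addrAC subrr add0r.
  rewrite {1}XE; apply: measureU => //.
  by apply/seteqP; split=> // z [[]].
move=> muE; have := measure_lt_oo mA A01 => /fineK muA.
move: muXA; rewrite muE -muA -EFinD lee_fin; lra.
Qed.

Lemma iter_imageS n : iter_image T n.+1 = T @` iter_image T n.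
Proof.
rewrite /iter_image; apply/seteqP; split=> [_ [x x01 <-]|_ [_ [x x01 <-] <-]].
  by exists (iter n T x) => //; exists x.
by exists x.
Qed.

Lemma iter_image01 n x : iter_image T n x -> 0 <= x < 1.
Proof.
move=> [z]; rewrite /= in_itv /= => z01 <-.
by elim: n => //= n; exact: T01.
Qed.

Lemma tame_iter_image n : tame (iter_image T n).
Proof.
elim: n => [|n IH].
  by rewrite /iter_image /= image_id; exact: tame_itv.
by rewrite iter_imageS; apply: tame_image => //; exact: iter_image01.
Qed.

(** The decreasing sequence of images is constant from the index where two
    consecutive ones agree. *)
Lemma finite_type_attractor : finite_type T ->
  [/\ tame (attractor T), forall x, attractor T x -> 0 <= x < 1 &
      T @` attractor T = attractor T].
Proof.
move=> [n nE].
have stable m : (n <= m)%N -> iter_image T m = iter_image T n.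
  move=> /subnK <-; elim: (m - n)%N => // k IH.
  by rewrite addSn iter_imageS IH -iter_imageS.
have dec m : iter_image T m.+1 `<=` iter_image T m.
  move=> z [x]; rewrite /= in_itv /= => x01 <-; exists (T x); last by rewrite -iterS iterSr.
  by rewrite /= in_itv; exact: T01.
have dec' m k : iter_image T (k + m) `<=` iter_image T m.
  by elim: k => // k IH x /dec /IH.
have -> : attractor T = iter_image T n.
  apply/seteqP; split=> [x /(_ n I)//|x xn m _].
  have [nm|mn] := leqP n m; first by rewrite stable.
  by apply: (dec' m (n - m)%N); rewrite subnK // ltnW.
split; [exact: tame_iter_image|exact: iter_image01|by rewrite -iter_imageS nE].
Qed.

Hypothesis indep : forall n m : nat -> int,
  \sum_(i < r) (n i)%:~R * gamma i + \sum_(i < r | (0 < i)%N) (m i)%:~R * beta i = 0 ->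
  (forall i, (i < r)%N -> n i = 0) /\ (forall i, (0 < i < r)%N -> m i = 0).

Theorem generic_finite_type : finite_type T -> irrational_rotation_type T.
Proof.
move=> fT; split=> // x Xx; have [tX X01 TX] := finite_type_attractor fT.
have [u [v [uv Xuv mX ->]]] := tame_component tX X01 Xx.
have XT z : attractor T z -> attractor T (T z) by move=> Xz; rewrite -TX; exists z.
have [alpha [irr h]] := component_rotation beta0 betar beta_lt TE indep X01 XT
  (tame_injective tX X01 TX) uv Xuv mX.
exists u, v, alpha; split=> // z; rewrite /= in_itv /=; exact: h.
Qed.

End FiniteType.

(** * Resonant parameters are negligible *)

Section Null.
Variable R : realType.

Definition hyperplane n (c : 'I_n -> R) (d : R) : set (n.-tuple R) :=
  [set t | \sum_i c i * tnth t i = d].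

Lemma measurable_hyperplane n (c : 'I_n -> R) d : measurable (hyperplane c d).
Proof.
have mf : measurable_fun [set: n.-tuple R] (fun t : n.-tuple R => \sum_(i < n) c i * tnth t i).
  apply: measurable_sum => i; apply: measurable_realfun.measurable_funM => //.
  exact: measurable_tnth.
rewrite (_ : hyperplane c d = setT `&` (fun t : n.-tuple R => \sum_(i < n) c i * tnth t i) @^-1` [set d]).
  exact: mf.
by rewrite setTI.
Qed.

(** If the equation involves a coordinate other than the first one, all sections
    at a fixed first coordinate are null by induction; otherwise the hyperplane is
    a product with a one-point factor. *)
Lemma hyperplane_null n (c : 'I_n -> R) d : (exists i, c i != 0) ->
  lebesgue_tuple R n (hyperplane c d) = 0%E.
Proof.
elim: n c d => [|n IH] c d [i0 ci0]; first by case: i0 ci0.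
have tailE (x : R) (t : n.-tuple R) : \sum_(i < n.+1) c i * tnth (cons_pair (x, t)) i =
    c ord0 * x + \sum_(i < n) c (lift ord0 i) * tnth t i.
  by rewrite big_ord_recl; congr (_ + _); apply: eq_bigr => i _; rewrite tnthS.
have [[i ci]|nc] := pselect (exists i, c (lift ord0 i) != 0).
  rewrite /= /cons_measure /pushforward /= /product_measure1.
  apply: integral0_eq => x _ /=.
  rewrite [X in lebesgue_tuple R n X](_ : _ =
      hyperplane (fun i => c (lift ord0 i)) (d - c ord0 * x)).
    by apply: IH; exists i.
  rewrite /xsection; apply/seteqP; split=> t /=; rewrite inE /hyperplane /= tailE.
    by move=> <-; ring.
  by move=> ->; ring.
have c0 : c ord0 != 0.
  by move: ci0; have [j ->|-> //] := unliftP ord0 i0 => cj; case: nc; exists j.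
have -> : hyperplane c d = (@cons_pair R n) @` ([set d / c ord0] `*` setT).
  apply/seteqP; split=> [t|_ [[x t] [/= -> _] <-]].
    case/tupleP: t => x t; rewrite /hyperplane /= (tailE x t) => E; exists (x, t) => //; split=> //=.
    apply: (mulfI c0); rewrite mulrCA mulfV // mulr1 -E big1 ?addr0 // => j _.
    by have [->|cj] := eqVneq (c (lift ord0 j)) 0; [rewrite mul0r|case: nc; exists j].
  rewrite /hyperplane /= tailE big1 ?addr0; first by rewrite mulrCA mulfV // mulr1.
  by move=> j _; have [->|cj] := eqVneq (c (lift ord0 j)) 0; [rewrite mul0r|case: nc; exists j].
rewrite /= /cons_measure /pushforward (_ : _ @^-1` _ = [set d / c ord0] `*` setT).
  by rewrite product_measure1E //= lebesgue_measure_set1 mul0e.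
apply/seteqP; split=> [[x t] [[x' t'] h /(congr1 val) /= [<- _]]|p hp]; last by exists p.
by case: h => /= ->.
Qed.
End Null.

Lemma sum_positive (V : nmodType) n (G : nat -> V) :
  \sum_(i < n | (0 < i)%N) G i = \sum_(j < n.-1) G j.+1.
Proof.
case: n => [|n]; first by rewrite !big_ord0.
by rewrite big_mkcond big_ord_recl /= add0r.
Qed.

Lemma sum_from (V : nmodType) n m (G : nat -> V) :
  \sum_(n <= i < m) G i = \sum_(j < m - n) G (j + n)%N.
Proof. by rewrite -{1}[n]add0n big_addn big_mkord. Qed.

Section Generic.
Variables (R : realType) (r : nat) (t : (2 * r - 1).-tuple R).
Hypothesis r2 : (2 <= r)%N.
Hypothesis tITM : ITM R r t.
Hypothesis generic : forall c : {ffun 'I_(2 * r - 1) -> int}, c != 0 ->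
  ~ hyperplane (fun i => (c i)%:~R) 0 t.

Lemma itm_beta0 : itm_beta r t 0 = 0. Proof. by []. Qed.

Lemma itm_betar : itm_beta r t r = 1.
Proof.
rewrite /itm_beta; case: r r2 t => // k _ u /=.
by rewrite nth_rcons size_drop size_tuple (_ : _ - _ = k)%N ?ltnn ?eqxx //; lia.
Qed.

Lemma itm_beta_inner i : (0 < i < r)%N -> itm_beta r t i = nth 0 t (r + i).-1.
Proof.
case: i => // i; rewrite /= /itm_beta /= addnS /= => ir.
by rewrite nth_rcons size_drop size_tuple ifT ?nth_drop //; lia.
Qed.

Lemma itm_beta_lt i : (i < r)%N -> itm_beta r t i < itm_beta r t i.+1.
Proof. by move=> /tITM[]. Qed.

Lemma itm_mapE i x : (i < r)%N -> itm_beta r t i <= x < itm_beta r t i.+1 ->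
  itm_map r t x = x + itm_gamma t i.
Proof.
move=> ir xi; rewrite /itm_map; congr (_ + _).
rewrite (bigD1 (Ordinal ir)) /= ?in_itv //= big1 ?addr0 // => j /andP[+ ji].
rewrite in_itv /= => xj; move: ji.
rewrite -val_eqE /= -(letter_eq itm_beta0 itm_betar itm_beta_lt (ltn_ord j) xj).
by rewrite (letter_eq itm_beta0 itm_betar itm_beta_lt ir xi) eqxx.
Qed.

Lemma itm_map01 x : 0 <= x < 1 -> 0 <= itm_map r t x < 1.
Proof.
move=> x01; have [lr lx] := letterP itm_beta0 itm_betar x01.
rewrite (itm_mapE lr lx); have [_] := tITM lr; rewrite in_itv /= => /andP[? ?].
by move/andP: lx => [? ?]; apply/andP; lra.
Qed.

(** The relation between the [gamma_i] and [beta_j] is one between the entries of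
    [t], with the coefficient [f j] at the place [j]. *)
Lemma itm_indep (n m : nat -> int) :
  \sum_(i < r) (n i)%:~R * itm_gamma t i +
    \sum_(i < r | (0 < i)%N) (m i)%:~R * itm_beta r t i = 0 ->
  (forall i, (i < r)%N -> n i = 0) /\ (forall i, (0 < i < r)%N -> m i = 0).
Proof.
move=> E; pose f j := if (j < r)%N then n j else m (j.+1 - r)%N.
pose c := [ffun j : 'I_(2 * r - 1) => f j].
have c0 : c = 0.
  apply/eqP; apply: contraT => /generic[]; rewrite /hyperplane /= -[RHS]E.
  transitivity (\sum_(j < 2 * r - 1) (f j)%:~R * nth 0 t j).
    by apply: eq_bigr => j _; rewrite ffunE (tnth_nth 0).
  rewrite -(big_mkord xpredT (fun j => (f j)%:~R * nth 0 t j)).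
  rewrite (big_cat_nat (n := r)) //=; last by lia.
  congr (_ + _).
    by rewrite big_mkord; apply: eq_bigr => j _; rewrite /f ltn_ord.
  rewrite sum_from (sum_positive r (fun i => (m i)%:~R * itm_beta r t i)) (_ : 2 * r - 1 - r = r.-1)%N; last by lia.
  apply: eq_bigr => j _; have := ltn_ord j => jr; rewrite itm_beta_inner; last by lia.
  rewrite /f ifF; last by lia.
  by congr ((m _)%:~R * nth 0 t _); lia.
have f0 j : (j < 2 * r - 1)%N -> f j = 0.
  by move=> jr; move/ffunP: c0 => /(_ (Ordinal jr)); rewrite !ffunE.
split=> i ir.
  by have := f0 i; rewrite /f ir; apply; lia.
have := f0 (r + i).-1; rewrite /f ifF; last by lia.
rewrite (_ : (r + i).-1.+1 - r = i)%N; last by lia.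
by apply; lia.
Qed.

Lemma generic_itm : finite_type (itm_map r t) -> irrational_rotation_type (itm_map r t).
Proof.
exact: (generic_finite_type itm_beta0 itm_betar itm_beta_lt itm_mapE itm_map01 itm_indep).
Qed.

End Generic.

Theorem mainTheorem7 (R : realType) :
  (forall r : nat, (2 <= r)%N ->
     (lebesgue_tuple R (2 * r - 1)).-negligible (infinite_type_maps R r)) ->
  forall r : nat, (2 <= r)%N ->
    (lebesgue_tuple R (2 * r - 1)).-negligible
      (ITM R r `\` irrational_rotation_maps R r).
Proof.
move=> BK r r2; pose C : countType := {ffun 'I_(2 * r - 1) -> int}.
pose F k : set ((2 * r - 1).-tuple R) :=
  if unpickle k is Some c then
    if (c : C) != 0 then hyperplane (fun i => (c i)%:~R) 0 else set0
  else set0.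
apply: (@negligibleS _ _ _ _ (infinite_type_maps R r `|` \bigcup_k F k)).
  move=> t [tI nrot]; have [fT|nfT] := pselect (finite_type (itm_map r t)); last by left.
  right; apply: contrapT => nF; apply: nrot; split=> //.
  apply: (generic_itm r2 tI) => // c c0 ht; apply: nF; exists (pickle c) => //.
  by rewrite /F (pickleK (c : C)) c0.
apply: negligibleU; first exact: BK.
apply: negligible_bigcup => k; rewrite /F.
case: (unpickle k) => [c|]; last exact: negligible_set0.
case: ifPn => [c0|_]; last exact: negligible_set0.
apply/negligibleP; first exact: measurable_hyperplane.
apply: hyperplane_null; apply/existsP; apply: contraNT c0.
rewrite negb_exists => /forallP c0; apply/eqP/ffunP => i.
by have := c0 i; rewrite negbK intr_eq0 ffunE => /eqP.
Qed.
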